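(* Let $m_1\ge m_2\ge\dots\ge m_n=0$ be integers. The base $\mathcal{F}_\gamma(a)$ (the Gelfand-Kapranov-Zelevinsky base) of the irreducible representation $V$ of $\mathfrak{gl}_n$ with highest weight $[m_1,\dots,m_n]$, where $\gamma$ runs over shift vectors corresponding to all Gelfand-Tsetlin diagrams with upper row $[m_1,\dots,m_n]$, is related to the Gelfand-Tsetlin base $G_\gamma(a)$ by a transformation that is upper-triangular with respect to the order $\preceq$; that is, for every such $\gamma$ $$\mathcal{F}_\gamma(a)=\sum_{\delta:\ \gamma+B\preceq\delta+B}c_{\gamma,\delta}\,G_\delta(a),\qquad c_{\gamma,\delta}\in\mathbb{C},\ c_{\gamma,\gamma}\ne0,$$ where $\delta$ runs over the shift vectors of the Gelfand-Tsetlin diagrams with the given upper row.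
   Context: Fix $n\ge2$. Functions on $GL_n(\mathbb{C})$ form a representation by right shifts $(Xf)(g)=f(gX)$, hence a representation of $\mathfrak{gl}_n$ (generators $E_{i,j}$). Let $a_i^j$ be the matrix element in row $j$, column $i$; for a nonempty proper subset $X=\{i_1<\dots<i_l\}\subset\{1,\dots,n\}$ put $a_X=a_{i_1,\dots,i_l}=\det(a_i^j)_{i=i_1,\dots,i_l}^{j=1,\dots,l}$. $V$ is the irreducible subrepresentation generated by the highest vector $v_0=\prod_{p=1}^{n-1}\frac{a_{1,\dots,p}^{m_p-m_{p+1}}}{(m_p-m_{p+1})!}$. Let $N=2^n-2$ and index coordinates of $\mathbb{Z}^N$ by nonempty proper subsets $X$ of $\{1,\dots,n\}$; $e_X$ are unit vectors. $B\subset\mathbb{Z}^N$ consists of all $v$ with $\sum_{X:\,|X\cap\{1,\dots,q\}|\ge p}v_X=0$ for all $1\le p\le q\le n$. For $1\le i<j<x\le n$ and $X$ (possibly empty) with all elements greater than $x$, put $v_+=e_{1,\dots,i-1,i,X}+e_{1,\dots,i-1,j,x,X}$, $v_0=e_{1,\dots,i-1,x,X}+e_{1,\dots,i-1,i,j,X}$ (juxtaposition of indices and $X$ means union of sets). Enumerate these quadruples by $\alpha=1,\dots,k$ and set $r^\alpha=v_0^\alpha-v_+^\alpha$, $sr=\sum_\alpha s_\alpha r^\alpha$ for $s\in\mathbb{Z}^k$. The partial order: $\gamma+B\preceq\delta+B$ if $\gamma+sr\equiv\delta \pmod B$ for some $s\in\mathbb{Z}^k_{\ge0}$. A Gelfand-Tsetlin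 diagram with upper row $[m_1,\dots,m_n]$ is an array of integers $m_{p,q}$, $1\le p\le q\le n$, with $m_{p,n}=m_p$ and $m_{p,q+1}\ge m_{p,q}\ge m_{p+1,q+1}$. The set of $x\in\mathbb{Z}^N$ with $\sum_{X:\,|X\cap\{1,\dots,q\}|\ge p}x_X=m_{p,q}$ for all $1\le p\le q\le n$ has the form $\gamma+B$; $\gamma$ (one fixed choice per diagram) is the shift vector of the diagram. $\mathcal{F}_\gamma(z)=\sum_{x\in\gamma+B}\frac{z^x}{x!}$, with $z^x=\prod_Xz_X^{x_X}$, $x!=\prod_Xx_X!$, $1/m!=0$ for negative integers $m$; $\mathcal{F}_\gamma(a)$ is obtained by $z_X=a_X$. $G_\gamma(a)$ denotes the Gelfand-Tsetlin base vector (defined up to a nonzero scalar) of $V$ corresponding to the diagram with shift vector $\gamma$: a nonzero vector which, for the chain $\mathfrak{gl}_n\supset\mathfrak{gl}_{n-1}\supset\dots\supset\mathfrak{gl}_1$ ($\mathfrak{gl}_q$ spanned by $E_{i,j}$, $i,j\le q$), lies for each $q$ in an irreducible $\mathfrak{gl}_q$-submodule with highest weight $(m_{1,q},\dots,m_{q,q})$. *)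

(* Defs.v *)
From HB Require Import structures.
From mathcomp Require Import all_boot all_order all_algebra.
From mathcomp Require Import complex.
From mathcomp Require Import all_classical all_reals all_analysis.

Set Implicit Arguments.
Unset Strict Implicit.
Unset Printing Implicit Defensive.

Import Order.TTheory GRing.Theory Num.Theory.
Import numFieldNormedType.Exports.

Local Open Scope classical_set_scope.
Local Open Scope ring_scope.

(* The indices 1, ..., n are represented by the elements 0, ..., n-1 of 'I_n:
   for q : 'I_n, [set k | k <= q]%SET below stands for {1, ..., q+1}, and a
   condition "at least p elements" with 1 <= p becomes p < _ with p : 'I_n.
   The number q of gl_q is in contrast a natural number, not an index.  The
   definitions are over a numFieldType C, to be instantiated with the complex
   numbers. *)

Section Representation.
Variables (C : numFieldType) (n : nat).

Definition GL : Type := {g : 'M[C]_n | g \in unitmx}.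

Definition GLone : GL := Sub 1%:M (unitmx1 C n).

Lemma GLmul_subproof (g h : GL) : val g *m val h \in unitmx.
Proof. by rewrite unitmx_mul (valP g) (valP h). Qed.

Definition GLmul (g h : GL) : GL := Sub (val g *m val h) (GLmul_subproof g h).

Definition rshift (X : GL) (f : GL -> C^o) : GL -> C^o :=
  fun g => f (GLmul g X).

(* The differential of the right shifts: (A f)(g) is the derivative at t = 0
   of (X(t) f)(g) along the curve X(t) = 1 + t A, which is tangent to exp(t A)
   at t = 0.  The matrix 1 + t A is invertible only for t near 0, whence the
   default value of insubd, which does not affect the derivative.  As usual for
   the library, the derivative has an arbitrary value where it does not exist;
   all functions considered below are polynomial in the matrix elements. *)
Definition gl_act (A : 'M[C]_n) (f : GL -> C^o) : GL -> C^o :=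
  fun g =>
    derive1 (fun t : C => rshift (insubd GLone (1%:M + t *: A)) f g) 0.

Definition Eact (i j : 'I_n) : (GL -> C^o) -> (GL -> C^o) :=
  gl_act (delta_mx i j).

Definition gl_submodule (q : nat) (W : set (GL -> C^o)) : Prop :=
  [/\ W 0,
      (forall (c : C) u v, W u -> W v -> W (c *: u + v)) &
      (forall i j : 'I_n, (i < q)%N -> (j < q)%N ->
         forall u, W u -> W (Eact i j u))].

Definition gl_irreducible (q : nat) (W : set (GL -> C^o)) : Prop :=
  [/\ gl_submodule q W,
      W <> [set 0] &
      (forall U, gl_submodule q U -> U `<=` W -> U = [set 0] \/ U = W)].

Definition gl_highest_vector (q : nat) (lam : 'I_n -> int)
    (w : GL -> C^o) : Prop :=
  [/\ w <> 0,
      (forall i j : 'I_n, (i < j)%N -> (j < q)%N -> Eact i j w = 0) &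
      (forall i : 'I_n, (i < q)%N -> Eact i i w = (lam i)%:~R *: w)].

Lemma card_le_n (X : {set 'I_n}) : (#|X| <= n)%N.
Proof. by apply: leq_trans (max_card _) _; rewrite card_ord. Qed.

(* enum_val lists the elements of X in increasing order, so this is the minor
   of g on the first #|X| rows and on the columns X. *)
Definition a_ (X : {set 'I_n}) (g : GL) : C :=
  \det (mxsub (widen_ord (card_le_n X)) (@enum_val _ (mem X)) (val g)).

Definition inv_fact (x : int) : C := if x is Posz k then (k`!)%:R^-1 else 0.

Definition highest_vector (m : 'I_n -> int) : GL -> C^o := fun g =>
  \prod_(p : 'I_n) \prod_(p' : 'I_n | p' == p.+1 :> nat)
    (a_ [set k : 'I_n | (k <= p)%N]%SET g ^ (m p - m p')
       * inv_fact (m p - m p')).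

Definition repV (m : 'I_n -> int) : set (GL -> C^o) :=
  [set f | forall W, gl_submodule n W -> W (highest_vector m) -> W f].

(* The row [m_(1,q), ..., m_(q,q)] of a diagram is the part p <= q of the
   column q of a matrix; the entries with q < p, absent from a diagram, are set
   to 0 so that a diagram corresponds to exactly one matrix. *)
Definition GT_diagram (m : 'I_n -> int) (D : 'M[int]_n) : Prop :=
  [/\ (forall p q : 'I_n, (q < p)%N -> D p q = 0),
      (forall p q : 'I_n, q.+1 = n -> D p q = m p) &
      (forall p q p' q' : 'I_n, (p <= q)%N ->
         p' = p.+1 :> nat -> q' = q.+1 :> nat ->
         D p' q' <= D p q <= D p q')].

Definition GT_vector (m : 'I_n -> int) (D : 'M[int]_n) (f : GL -> C^o) : Prop :=
  [/\ f <> 0, repV m f &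
      forall q : 'I_n, exists W : set (GL -> C^o),
        [/\ W `<=` repV m, gl_irreducible q.+1 W,
            (exists2 w, W w & gl_highest_vector q.+1 (D^~ q) w) & W f]].

End Representation.

Section Lattice.
Variable n : nat.

Definition psub : Type := {X : {set 'I_n} | (0 < #|X| < n)%N}.

Definition unit_vec (Y : {set 'I_n}) : {ffun psub -> int} :=
  [ffun X => (val X == Y)%:R].

Definition level_sum (p q : 'I_n) (v : {ffun psub -> int}) : int :=
  \sum_(X : psub | (p < #|val X :&: [set k : 'I_n | (k <= q)%N]%SET|)%N) v X.

Definition latB : set {ffun psub -> int} :=
  [set v | forall p q : 'I_n, (p <= q)%N -> level_sum p q v = 0].

Definition coset (gam : {ffun psub -> int}) : set {ffun psub -> int} :=
  [set x | latB (x - gam)].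

Definition is_quad (t : 'I_n * 'I_n * 'I_n * {set 'I_n}) : bool :=
  let: (i, j, x, X) := t in
  [&& (i < j)%N, (j < x)%N & [forall y in X, (x < y)%N]].

Definition quad : Type := {t | is_quad t}.

Definition vplus (al : quad) : {ffun psub -> int} :=
  let: (i, j, x, X) := val al in
  let I := [set k : 'I_n | (k < i)%N]%SET in
  unit_vec (I :|: [set i]%SET :|: X) + unit_vec (I :|: [set j; x]%SET :|: X).

Definition vzero (al : quad) : {ffun psub -> int} :=
  let: (i, j, x, X) := val al in
  let I := [set k : 'I_n | (k < i)%N]%SET in
  unit_vec (I :|: [set x]%SET :|: X) + unit_vec (I :|: [set i; j]%SET :|: X).

Definition rvec (al : quad) : {ffun psub -> int} := vzero al - vplus al.

Definition coset_le (gam del : {ffun psub -> int}) : Prop :=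
  exists s : quad -> nat, latB (gam + \sum_(al : quad) rvec al *+ s al - del).

Definition shift_vector (D : 'M[int]_n) (gam : {ffun psub -> int}) : Prop :=
  forall p q : 'I_n, (p <= q)%N -> level_sum p q gam = D p q.

End Lattice.

Section GammaSeries.
Variables (C : numFieldType) (n : nat).

(* A term with a negative exponent vanishes by the convention on inv_fact, so
   for shift vectors of diagrams only finitely many terms are nonzero. *)
Definition Fseries (gam : {ffun psub n -> int}) (z : psub n -> C) : C :=
  \sum_(x \in coset gam) \prod_(X : psub n) (z X ^ x X * inv_fact C (x X)).

Definition Fvec (gam : {ffun psub n -> int}) : GL C n -> C^o :=
  fun g => Fseries gam (fun X => a_ (val X) g).

End GammaSeries.

(* Main.v *)
Require Import Defs.
From HB Require Import structures.
From mathcomp Require Import all_boot all_order all_algebra.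
From mathcomp Require Import perm.
From mathcomp Require ssrcomplements mpoly.
From mathcomp Require Import zify ring.

Set Implicit Arguments.
Unset Strict Implicit.
Unset Printing Implicit Defensive.

Import Order.TTheory GRing.Theory Num.Theory.

Local Open Scope ring_scope.

(** Every function involved is a polynomial in the matrix entries x_(p,j), p the
row and j the column, so the theorem is a statement about coefficients of
polynomials.  The group acts on columns: E_(i,j) is the sum over p of
x_(p,i) d/dx_(p,j).  The row operators, the sums over the columns c of
x_(p,c) d/dx_(r,c), commute with this action.  Let S be the space of the
polynomials that are killed by the row operators with p < r and have degree
m_p in the p-th row.  It is stable under gl_n and contains v_0, hence V
([repV_poly]).  The Gelfand-Kapranov-Zelevinsky vectors are in S because they
are sums of products of minors on the first rows.

A monomial has contents: its degree in row p and in the columns up to q, for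
all p and q, an array of the shape of a diagram.  Monomials are compared
lexicographically, the last column first and inside a column the lowest row
first.  Three facts about leading monomials give the theorem.

- The contents of the leading monomial of a nonzero f in S form a diagram
  ([mlead_interlace], [GT_diagram_mlead]).  Indeed, if this monomial has degree
  b in the entry of row p + 1 and column q, then collecting the terms of f by
  their exponents in the columns from q on exhibits a highest vector, for the
  sl_2 acting on the rows p and p + 1 of the columns before q, that is a b-th
  raising once the entries in column q are left aside.  A highest vector of
  weight smaller than b is orthogonal to all b-th raisings for the Fischer
  inner product, so b is at most its weight, and this is the betweenness
  condition.

- The leading monomial of a Gelfand-Tsetlin vector has contents its diagram D,
  and the contents of its other monomials are below D: for each q, their row
  for q is smaller in the dominance order ([content_mlead],
  [content_dominated]).  To see this, let w be the highest vector of the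
  irreducible gl_q-module W that contains the vector.  Extracting the terms
  with given exponents in the columns after q commutes with gl_q, so that,
  W being irreducible, it kills both vectors or none; this also holds for its
  composites with row operators.  Thus the row degrees of the extracted terms
  can be read off from w.  After raising as long as possible one gets a highest
  vector for rows and columns at once, and the leading monomial of such a
  polynomial only contains diagonal entries ([bihighest_content]): its row
  degrees are its column degrees, which are the weight of w.

- All monomials of a minor are below its diagonal monomial ([leading_minor]),
  and the product of the diagonal monomials of the minors in a^x only depends
  on the diagram of x.  So all monomials of the Gelfand-Kapranov-Zelevinsky
  vector of D are below D, and the coefficient of the monomial with contents D
  is the sum of the 1 / x!, which is positive because D has a filling by
  columns ([gamma_poly_lead]).

Subtracting multiples of Gelfand-Tsetlin vectors so as to cancel leading
monomials then expands any element of S, and below D stays below D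
([triangular_expansion]).  Finally adding r^alpha with x = j + 1 moves one unit
of the row for q = j of a diagram from place i to place i + 1, so the dominance
order on all rows is the order on cosets ([coset_le_of_dominance]). *)

Module MatrixPolynomials.
Import ssrcomplements mpoly.

(** * Polarization operators *)
Section Polarization.
Variables (C : comNzRingType) (N : nat).
Implicit Types (a b c d : 'I_N) (f g : {mpoly C[N]}) (m k : 'X_{1..N}).

Definition polar a b f := 'X_a * f^`M(b).

Lemma polar_is_linear a b : linear (polar a b).
Proof. by move=> k f g; rewrite /polar mderivD mderivZ mulrDr scalerAr. Qed.

HB.instance Definition _ a b :=
  GRing.isLinear.Build C {mpoly C[N]} {mpoly C[N]} _ (polar a b)
    (polar_is_linear a b).

Lemma mnm_subK m a : (0 < m a)%N -> exists m', m = (m' + U_(a))%MM.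
Proof.
move=> ma; exists (m - U_(a))%MM; rewrite submK //.
by rewrite lep1mP -lt0n.
Qed.

Lemma mcoeff_polar a b f m :
  (polar a b f)@_(m + U_(a)) = f@_(m + U_(b)) *+ (m b).+1.
Proof. by rewrite /polar -commr_mpolyX [in LHS]addmC mcoeffMX mcoeff_mderiv. Qed.

Lemma mcoeff_polar0 a b f m : m a = 0%N -> (polar a b f)@_m = 0.
Proof.
move=> ma; apply/eqP/negPn/negP; rewrite /polar -commr_mpolyX -mcoeff_msupp.
rewrite (perm_mem (msuppMX _ _)) => /mapP[k _ mE].
by move: ma; rewrite mE mnmDE mnm1E eqxx.
Qed.

Lemma msupp_polar a b f m : m \in msupp (polar a b f) ->
  exists2 k, m = (k + U_(a))%MM & (k + U_(b))%MM \in msupp f.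
Proof.
rewrite mcoeff_msupp => fm; case: (posnP (m a)) => [m0|/mnm_subK[k mE]].
  by rewrite mcoeff_polar0 ?eqxx in fm.
exists k => //; rewrite mcoeff_msupp; apply: contraNneq fm => fk.
by rewrite mE mcoeff_polar fk mul0rn.
Qed.

Lemma mcoeff_polar_diag a f m : (polar a a f)@_m = f@_m *+ m a.
Proof.
case: (posnP (m a)) => [m0|/mnm_subK[k ->]]; first by rewrite mcoeff_polar0 // m0.
by rewrite mcoeff_polar mnmDE mnm1E eqxx addn1.
Qed.

Lemma mderiv_var a b : ('X_a : {mpoly C[N]})^`M(b) = (a == b)%:R.
Proof.
rewrite mderivX mnm1E; case: eqVneq => [->|_]; last by rewrite scale0r.
rewrite scale1r; have -> : (U_(b) - U_(b) = 0 :> 'X_{1..N})%MM.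
  by apply/mnmP=> i; rewrite mnmBE mnm0E subnn.
by rewrite mpolyX0.
Qed.

Lemma polar_comm a b c d f :
  polar a b (polar c d f) =
  polar c d (polar a b f) + (c == b)%:R * polar a d f
    - (a == d)%:R * polar c b f.
Proof.
rewrite /polar !mderivM !mderiv_var (mderiv_comm b d); ring.
Qed.

Definition mproj (P : pred 'X_{1..N}) f :=
  \sum_(m <- msupp f | P m) f@_m *: 'X_[m].

Lemma mcoeff_mproj P f m : (mproj P f)@_m = if P m then f@_m else 0.
Proof.
rewrite /mproj raddf_sum /=; under eq_bigr do rewrite mcoeffZ mcoeffX.
case: (boolP (m \in msupp f)) => mf; last first.
  rewrite memN_msupp_eq0 // if_same big1_seq // => k /andP[_ kf].
  have /negPf -> : k != m by apply: contraNneq mf => <-.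
  by rewrite mulr0.
rewrite big_mkcond (bigD1_seq m) ?msupp_uniq //= eqxx mulr1 big1 ?addr0 //.
by move=> k /negPf ->; rewrite mulr0 if_same.
Qed.

Lemma mproj_is_linear P : linear (mproj P).
Proof.
move=> c f g; apply/mpolyP=> m; rewrite mcoeffD mcoeffZ !mcoeff_mproj.
by rewrite mcoeffD mcoeffZ; case: ifP; rewrite ?mulr0 ?addr0.
Qed.

HB.instance Definition _ P :=
  GRing.isLinear.Build C {mpoly C[N]} {mpoly C[N]} _ (mproj P)
    (mproj_is_linear P).

Lemma msupp_mproj P f m : (m \in msupp (mproj P f)) = P m && (m \in msupp f).
Proof. by rewrite !mcoeff_msupp mcoeff_mproj; case: ifP => //=; rewrite eqxx. Qed.

(** x_a d/dx_b takes the coefficient at m + U_b to m + U_a.  This lets the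
extraction of terms with prescribed exponents pass through row and column
operators. *)
Lemma mproj_polar P P' a b f :
    (forall m, P (m + U_(a))%MM = P' (m + U_(b))%MM) ->
  mproj P (polar a b f) = polar a b (mproj P' f).
Proof.
move=> PP'; apply/mpolyP => m; rewrite mcoeff_mproj.
case: (posnP (m a)) => [m0|/mnm_subK[k ->]]; first by rewrite !mcoeff_polar0 ?if_same.
by rewrite !mcoeff_polar mcoeff_mproj PP'; case: ifP; rewrite ?mul0rn.
Qed.

End Polarization.

(** * The Fischer inner product *)
Section Fischer.
Variables (C : numClosedFieldType) (N : nat).
Implicit Types (a b : 'I_N) (f g : {mpoly C[N]}) (m : 'X_{1..N}).

Definition mfact m := (\prod_i (m i)`!)%N.

Lemma mfactDU m a : mfact (m + U_(a)) = ((m a).+1 * mfact m)%N.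
Proof.
rewrite /mfact (bigD1 a) //= [in RHS](bigD1 a) //= mnmDE mnm1E eqxx addn1 factS.
rewrite -!mulnA; do 2!congr muln; apply: eq_bigr => i /negPf ia.
by rewrite mnmDE mnm1E eq_sym ia addn0.
Qed.

Lemma mfact_gt0 m : (0 < mfact m)%N.
Proof. by apply: prodn_gt0 => i; rewrite fact_gt0. Qed.

(** The conjugated argument comes first, so that [fischer g] is a linear form. *)
Definition fischer g f := \sum_(m <- msupp f) f@_m * ((g@_m)^* * (mfact m)%:R).

Lemma fischerwE k f g : (msize f <= k)%N ->
  fischer g f = \sum_(m : 'X_{1..N < k}) f@_m * ((g@_m)^* * (mfact m)%:R).
Proof.
move=> lt_fk; pose I : subFinType _ := 'X_{1..N < k}.
rewrite /fischer (big_mksub I) //=; first last.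
+ by move=> m /msize_mdeg_lt /leq_trans; apply.
+ by rewrite msupp_uniq.
rewrite big_rmcond //= => m; rewrite -mcoeff_eq0 => /eqP ->.
by rewrite mul0r.
Qed.

Lemma fischer_is_linear g : scalar (fischer g).
Proof.
move=> c f f'; set K := maxn (msize f) (msize f').
have Kf : (msize f <= K)%N by rewrite leq_maxl.
have Kf' : (msize f' <= K)%N by rewrite leq_maxr.
have Kff' : (msize (c *: f + f') <= K)%N.
  apply: leq_trans (mmeasureD_le _ _ _) _; rewrite geq_max Kf' andbT.
  by apply: leq_trans Kf; apply: mmeasureZ_le.
rewrite !(@fischerwE K) // big_distrr -big_split /=; apply: eq_bigr => m _.
by rewrite mcoeffD mcoeffZ; ring.
Qed.

HB.instance Definition _ g :=
  GRing.isLinear.Build C {mpoly C[N]} C _ (fischer g) (fischer_is_linear g).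

Lemma fischerX m g : fischer g 'X_[m] = (g@_m)^* * (mfact m)%:R.
Proof. by rewrite /fischer msuppX big_seq1 mcoeffX eqxx mul1r. Qed.

Lemma fischer0l f : fischer 0 f = 0.
Proof. by rewrite /fischer big1 // => m _; rewrite mcoeff0 conjC0 mul0r mulr0. Qed.

Lemma fischerZl c f g : fischer (c *: g) f = c^* * fischer g f.
Proof.
rewrite /fischer big_distrr /=; apply: eq_bigr => m _.
by rewrite mcoeffZ rmorphM /=; ring.
Qed.

Lemma fischer_def f : fischer f f = 0 -> f = 0.
Proof.
move=> /eqP; rewrite /fischer psumr_eq0 => [/allP f0|m _]; last first.
  by rewrite mulrA mulr_ge0 ?mul_conjC_ge0 ?ler0n.
apply: msuppnil0; case E: (msupp f) f0 => [//|m s] /(_ m).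
rewrite mem_head => /(_ isT) /=.
have : m \in msupp f by rewrite E mem_head.
rewrite mcoeff_msupp mulrA !mulf_eq0 pnatr_eq0 conjC_eq0 => /negPf ->.
by rewrite /= => /eqP mf0; have := mfact_gt0 m; rewrite mf0.
Qed.

Lemma linear_mpolyX_ext (phi psi : {linear {mpoly C[N]} -> C | *%R}) :
  (forall m, phi 'X_[m] = psi 'X_[m]) -> phi =1 psi.
Proof.
move=> phiE f; rewrite [f]mpolyE !raddf_sum /=; apply: eq_bigr => m _.
by rewrite !linearZ /= phiE.
Qed.

Lemma polarX a b m :
  polar a b 'X_[m + U_(b)] = (m b).+1%:R *: 'X_[m + U_(a)] :> {mpoly C[N]}.
Proof.
rewrite /polar mderivX mnmDE mnm1E eqxx addn1 -scalerAr -mpolyXD addmK.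
by rewrite addmC.
Qed.

(** Multiplication by a variable is adjoint to the derivation with respect to
it: on monomials, the factor m! of the inner product absorbs the exponent
that the derivation brings down. *)
Lemma fischer_polar a b f g : fischer g (polar a b f) = fischer (polar b a g) f.
Proof.
pose phi := (fischer g \o polar a b) : {linear {mpoly C[N]} -> C | *%R}.
apply: (@linear_mpolyX_ext phi (fischer (polar b a g))) => m /=.
rewrite /phi /= fischerX; case: (posnP (m b)) => [m0|/mnm_subK[k ->]].
  by rewrite /polar mderivX m0 scale0r mulr0 raddf0 mcoeff_polar0 // conjC0 mul0r.
rewrite polarX linearZ /= fischerX mcoeff_polar !mfactDU rmorphMn /= !natrM.
by rewrite -mulr_natr; ring.
Qed.

End Fischer.

(** * Monomials in the entries of a matrix *)
Section MatrixVariables.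
Variable n : nat.
Implicit Types (p r i j c : 'I_n) (m : 'X_{1..n * n}) (Q : nat).

Lemma var_subproof p j : (j * n + p < n * n)%N.
Proof.
have := ltn_ord p; have := ltn_ord j.
by move: (j : nat) (p : nat) => a b; nia.
Qed.

(** Variables are numbered backwards: the order on monomials compares the
variable with the least index first, which here is the entry of the last row
and column, followed by the entries above it, then by the column before. *)
Definition var p j : 'I_(n * n) := rev_ord (Ordinal (var_subproof p j)).

Lemma var_lt p j r c : (var p j < var r c)%N = (c < j)%N || ((c == j) && (r < p)%N).
Proof.
have hp := ltn_ord p; have hj := ltn_ord j.
have hr := ltn_ord r; have hc := ltn_ord c.
have := var_subproof p j; have := var_subproof r c.
rewrite /= -val_eqE /=.
move: (p : nat) (j : nat) (r : nat) (c : nat) hp hj hr hc => a b d e *.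
apply/idP/idP => [h|]; last first.
  case/orP => [h|/andP[/eqP h h']]; first by nia.
  by subst; lia.
case: (ltngtP e b) => /= [//|h'|h']; first by nia.
by subst; lia.
Qed.

Lemma var_eqE p j r c : (var p j == var r c) = (p == r) && (j == c).
Proof.
apply/eqP/andP => [e|[/eqP-> /eqP->] //].
have := var_lt p j r c; have := var_lt r c p j; rewrite e ltnn -!val_eqE /=.
by case: ltngtP => //= _; case: ltngtP.
Qed.

Lemma varP (k : 'I_(n * n)) : exists p j, k = var p j.
Proof.
have lt_k := ltn_ord (rev_ord k); set k' := rev_ord k in lt_k.
have n0 : (0 < n)%N.
  by have := leq_ltn_trans (leq0n _) lt_k; rewrite muln_gt0 => /andP[].
have hj : (k' %/ n < n)%N by rewrite ltn_divLR.
have hp : (k' %% n < n)%N by rewrite ltn_mod.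
exists (Ordinal hp), (Ordinal hj).
rewrite /var -[k]rev_ordK -/k'; congr rev_ord; apply: val_inj => /=.
exact: divn_eq.
Qed.

Lemma mnm_varP m1 m2 : (forall p j, m1 (var p j) = m2 (var p j)) -> m1 = m2.
Proof. by move=> e; apply/mnmP => k; have [p [j ->]] := varP k. Qed.

Lemma big_var (T : Type) (idx : T) (op : Monoid.com_law idx) (F : 'I_(n * n) -> T) :
  \big[op/idx]_k F k = \big[op/idx]_p \big[op/idx]_c F (var p c).
Proof.
rewrite pair_bigA /= (reindex (fun pc : 'I_n * 'I_n => var pc.1 pc.2)) //=.
apply: onW_bij; apply: inj_card_bij; last by rewrite card_prod !card_ord.
by move=> [p c] [p' c'] /= /eqP; rewrite var_eqE => /andP[/eqP-> /eqP->].
Qed.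

Lemma mnmU_var p j r c : (U_(var p j))%MM (var r c) = (p == r) && (j == c) :> nat.
Proof. by rewrite mnm1E var_eqE. Qed.

Definition mnmvE := (@mnmDE (n * n), mnmU_var).

Lemma ltmc_var m1 m2 p j : mdeg m1 = mdeg m2 ->
  (forall r c, (j < c)%N || ((j == c) && (p < r)%N) ->
     m1 (var r c) = m2 (var r c)) ->
  (m1 (var p j) < m2 (var p j))%N -> (m1 < m2)%O.
Proof.
move=> eqd eqm ltm; apply/(ltmcP eqd); exists (var p j) => // k.
by have [r [c ->]] := varP k; rewrite var_lt => /eqm.
Qed.

(** Of the four variables involved, (r, j) is compared first. *)
Lemma ltmc_exchange m p r i j : (p < r)%N -> (i < j)%N ->
  ((m + U_(var r i) + U_(var p j))%MM < (m + U_(var p i) + U_(var r j))%MM)%O.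
Proof.
move=> lt_pr lt_ij; apply: (@ltmc_var _ _ r j).
- by rewrite !mdegD !mdeg1.
- move=> s c h; rewrite !mnmvE -!val_eqE /=.
  move: h; rewrite -!val_eqE /=; move: lt_pr lt_ij.
  by do ?case: eqP => //=; lia.
- rewrite !mnmvE -!val_eqE /= !eqxx.
  by rewrite (ltn_eqF lt_pr) (ltn_eqF lt_ij) andbF /= !addn0 addn1.
Qed.

Definition row_content Q p m : nat := \sum_(c < n | (c < Q)%N) m (var p c).
Definition col_content j m : nat := \sum_(p < n) m (var p j).

Lemma row_contentD Q p m1 m2 :
  row_content Q p (m1 + m2)%MM = (row_content Q p m1 + row_content Q p m2)%N.
Proof. by rewrite /row_content -big_split; apply: eq_bigr => c _; rewrite mnmDE. Qed.

Lemma row_contentU Q p r c :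
  row_content Q p U_(var r c)%MM = (r == p) && (c < Q)%N.
Proof.
rewrite /row_content; under eq_bigr do rewrite mnmU_var.
case: (ltnP c Q) => cQ; last first.
  rewrite andbF big1 // => i iQ; case: (eqVneq c i) => [e|]; last by rewrite andbF.
  by rewrite e leqNgt iQ in cQ.
rewrite (bigD1 c) //= eqxx !andbT big1 ?addn0 // => i /andP[_ /negPf].
by rewrite eq_sym => ->; rewrite andbF.
Qed.

Lemma col_contentD j m1 m2 :
  col_content j (m1 + m2)%MM = (col_content j m1 + col_content j m2)%N.
Proof. by rewrite /col_content -big_split; apply: eq_bigr => c _; rewrite mnmDE. Qed.

Lemma col_contentU j r c : col_content j U_(var r c)%MM = (c == j).
Proof.
rewrite /col_content; under eq_bigr do rewrite mnmU_var.
rewrite (bigD1 r) //= eqxx big1 ?addn0 // => i /negPf.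
by rewrite eq_sym => ->.
Qed.

Lemma sum_row_content Q m :
  (\sum_(p < n) row_content Q p m = \sum_(j < n | (j < Q)%N) col_content j m)%N.
Proof. by rewrite exchange_big. Qed.

End MatrixVariables.

(** * Row and column operators *)
Section Operators.
Variables (C : numFieldType) (n : nat).
Implicit Types (p r s i j c : 'I_n) (m : 'X_{1..n * n}) (Q : nat).
Implicit Types (f g v : {mpoly C[n * n]}).

(** [colop i j] is the action of E_(i,j) on polynomials.  [rowop Q] is the
infinitesimal left multiplication on the first Q columns only: these row
operators commute with gl_Q. *)
Definition colop i j f := \sum_(p < n) polar (var p i) (var p j) f.
Definition rowop Q p r f := \sum_(c < n | (c < Q)%N) polar (var p c) (var r c) f.

Lemma colop_is_linear i j : linear (colop i j).
Proof.
move=> k f g; rewrite /colop scaler_sumr -big_split; apply: eq_bigr => p _.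
by rewrite linearP.
Qed.
HB.instance Definition _ i j :=
  GRing.isLinear.Build C {mpoly C[n * n]} {mpoly C[n * n]} _ (colop i j)
    (colop_is_linear i j).

Lemma rowop_is_linear Q p r : linear (rowop Q p r).
Proof.
move=> k f g; rewrite /rowop scaler_sumr -big_split; apply: eq_bigr => c _.
by rewrite linearP.
Qed.
HB.instance Definition _ Q p r :=
  GRing.isLinear.Build C {mpoly C[n * n]} {mpoly C[n * n]} _ (rowop Q p r)
    (rowop_is_linear Q p r).

Lemma sum_delta (I : finType) (P : pred I) (a : I) (F : I -> {mpoly C[n * n]}) :
  P a -> \sum_(x | P x) (x == a)%:R * F x = F a.
Proof.
move=> Pa; rewrite (bigD1 a) //= eqxx mul1r big1 ?addr0 // => x /andP[_ /negPf->].
by rewrite mul0r.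
Qed.

(** The two commutators that arise, from a common variable on one or on the
other side, give the same polarization with opposite signs. *)
Lemma colop_rowop Q i j p r f : (i < Q)%N -> (j < Q)%N ->
  colop i j (rowop Q p r f) = rowop Q p r (colop i j f).
Proof.
move=> iQ jQ.
pose A := \sum_(s < n) \sum_(c < n | (c < Q)%N)
  polar (var p c) (var r c) (polar (var s i) (var s j) f).
pose B := polar (var p i) (var r j) f.
have -> : rowop Q p r (colop i j f) = A.
  by rewrite /rowop /colop /A exchange_big; apply: eq_bigr => c _; rewrite raddf_sum.
have -> : colop i j (rowop Q p r f) = A + B - B.
  rewrite {1}/B -(@sum_delta _ predT p (fun s => polar (var s i) (var r j) f) isT).
  rewrite /B -(@sum_delta _ predT r (fun s => polar (var p i) (var s j) f) isT).
  rewrite /colop /A -big_split -sumrB; apply: eq_bigr => s _ /=.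
  rewrite /rowop raddf_sum /=.
  rewrite -(@sum_delta _ (fun c : 'I_n => (c < Q)%N) j
    (fun c => polar (var s i) (var r c) f) jQ).
  rewrite -(@sum_delta _ (fun c : 'I_n => (c < Q)%N) i
    (fun c => polar (var p c) (var s j) f) iQ).
  rewrite !big_distrr -big_split -sumrB; apply: eq_bigr => c _ /=.
  rewrite polar_comm !var_eqE -!mulnb !natrM !mulrA (eq_sym p) (eq_sym i).
  by [].
by rewrite addrK.
Qed.

(** The relation [e, f] = h of sl_2 in rows p and r. *)
Lemma rowop_lower Q p r f :
  rowop Q p r (rowop Q r p f) =
  rowop Q r p (rowop Q p r f) + (rowop Q p p f - rowop Q r r f).
Proof.
rewrite /rowop.
pose A := \sum_(c < n | (c < Q)%N) \sum_(d < n | (d < Q)%N)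
  polar (var r d) (var p d) (polar (var p c) (var r c) f).
have -> : \sum_(c < n | (c < Q)%N) polar (var r c) (var p c)
    (\sum_(d < n | (d < Q)%N) polar (var p d) (var r d) f) = A.
  by rewrite /A exchange_big; apply: eq_bigr => c _; rewrite raddf_sum.
rewrite /A -sumrB -big_split; apply: eq_bigr => c cQ.
rewrite raddf_sum /=; under eq_bigr do rewrite polar_comm !var_eqE !eqxx /=.
rewrite sumrB big_split /= -addrA; congr (_ + (_ - _)).
  by rewrite (@sum_delta _ (fun c : 'I_n => (c < Q)%N) c
    (fun d => polar (var p c) (var p d) f) cQ).
under eq_bigr do rewrite eq_sym.
by rewrite (@sum_delta _ (fun c : 'I_n => (c < Q)%N) c
  (fun d => polar (var r d) (var r c) f) cQ).
Qed.

Lemma msupp_colop i j f m : m \in msupp (colop i j f) ->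
  exists p, exists2 k, m = (k + U_(var p i))%MM & (k + U_(var p j))%MM \in msupp f.
Proof.
rewrite mcoeff_msupp /colop raddf_sum /= => nz.
have [p /negPf hp] : exists p, (polar (var p i) (var p j) f)@_m != 0.
  apply/existsP; apply: contraNT nz => /existsPn h.
  by rewrite big1 // => p _; apply/eqP; have := h p; rewrite negbK.
by exists p; apply/msupp_polar; rewrite mcoeff_msupp hp.
Qed.

Lemma msupp_rowop Q p r f m : m \in msupp (rowop Q p r f) ->
  exists2 c : 'I_n, (c < Q)%N &
    exists2 k, m = (k + U_(var p c))%MM & (k + U_(var r c))%MM \in msupp f.
Proof.
rewrite mcoeff_msupp /rowop raddf_sum /= => nz.
have [c /andP[cQ hc]] : exists c : 'I_n,
    (c < Q)%N && ((polar (var p c) (var r c) f)@_m != 0).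
  apply/existsP; apply: contraNT nz => /existsPn h.
  by rewrite big1 // => c cQ; apply/eqP; have := h c; rewrite cQ /= negbK.
by exists c => //; apply/msupp_polar; rewrite mcoeff_msupp.
Qed.

Lemma mcoeff_rowop_diag Q p f m :
  (rowop Q p p f)@_m = f@_m *+ row_content Q p m.
Proof.
rewrite /rowop raddf_sum /= -sumrMnr; apply: eq_bigr => c _.
exact: mcoeff_polar_diag.
Qed.

Lemma mcoeff_colop_diag j f m : (colop j j f)@_m = f@_m *+ col_content j m.
Proof.
rewrite /colop raddf_sum /= -sumrMnr; apply: eq_bigr => c _.
exact: mcoeff_polar_diag.
Qed.

Definition col_invariant Q (P : pred 'X_{1..n * n}) :=
  forall p i j, (i < Q)%N -> (j < Q)%N ->
    forall m, P (m + U_(var p i))%MM = P (m + U_(var p j))%MM.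

Lemma colop_mproj Q P i j f : col_invariant Q P -> (i < Q)%N -> (j < Q)%N ->
  colop i j (mproj P f) = mproj P (colop i j f).
Proof.
move=> hP iQ jQ; rewrite /colop raddf_sum /=; apply: eq_bigr => p _.
by rewrite (mproj_polar (P' := P)) //; apply: hP.
Qed.

(** Suppose that x_(p,j), j < p, divides the leading monomial and replace it by
x_(j,j).  The coefficient of [rowop Q j p v], which is 0, at the resulting
monomial combines those of v at the leading monomial and at the monomials
obtained from it by exchanging x_(p,j) x_(j,c) for x_(j,j) x_(p,c).  For j < c
such a monomial is larger, hence absent from v; for c < j the entry x_(j,c) is
below the diagonal in an earlier column, which an induction on j excludes. *)
Lemma mlead_below Q v p j :
    v != 0 -> (forall q r : 'I_n, (q < r)%N -> rowop Q q r v = 0) ->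
  (j < Q)%N -> (j < p)%N -> mlead v (var p j) = 0%N.
Proof.
move=> v0 hv; have [k lek] := ubnP (j : nat).
elim: k j lek p => // k IH j; rewrite ltnS => lejk p jQ jp.
case: (posnP (mlead v (var p j))) => // /mnm_subK [m1 mE].
have := congr1 (mcoeff (m1 + U_(var j j))) (hv j p jp).
rewrite mcoeff0 /rowop raddf_sum (bigD1 j) //= mcoeff_polar -mE big1 ?addr0.
  by move/eqP; rewrite mulrn_eq0 /= mleadc_eq0 (negPf v0).
move=> c /andP[cQ ncj].
case: (posnP (m1 (var j c))) => [m10|/mnm_subK[m2 m1E]].
  by rewrite mcoeff_polar0 // !mnmvE m10 eqxx eq_sym (negPf ncj).
have -> : (m1 + U_(var j j) = m2 + U_(var j j) + U_(var j c))%MM.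
  by rewrite m1E -!addmA; congr (_ + _)%MM; rewrite addmC.
rewrite mcoeff_polar mcoeff_gt_mlead ?mul0rn // mE m1E.
have [lt_cj | lt_jc | /val_inj e] := ltngtP c j; last by rewrite e eqxx in ncj.
  have : mlead v (var j c) = 0%N by apply: IH => //; apply: leq_trans lejk.
  by rewrite mE m1E !mnmvE !eqxx addn1 addSn.
rewrite -addmA (addmC U_(var j c)%MM) addmA; exact: ltmc_exchange.
Qed.

(** The argument of [mlead_below] with rows and columns interchanged. *)
Lemma mlead_right Q v p j :
    v != 0 -> (forall i c : 'I_n, (i < c)%N -> (c < Q)%N -> colop i c v = 0) ->
  (j < Q)%N -> (p < j)%N -> mlead v (var p j) = 0%N.
Proof.
move=> v0 hv; have [k lek] := ubnP (p : nat).
elim: k p lek j => // k IH p; rewrite ltnS => lepk j jQ pj.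
case: (posnP (mlead v (var p j))) => // /mnm_subK [m1 mE].
have := congr1 (mcoeff (m1 + U_(var p p))) (hv p j pj jQ).
rewrite mcoeff0 /colop raddf_sum (bigD1 p) //= mcoeff_polar -mE big1 ?addr0.
  by move/eqP; rewrite mulrn_eq0 /= mleadc_eq0 (negPf v0).
move=> r nrp.
case: (posnP (m1 (var r p))) => [m10|/mnm_subK[m2 m1E]].
  by rewrite mcoeff_polar0 // !mnmvE m10 eqxx andbT eq_sym (negPf nrp).
have -> : (m1 + U_(var p p) = m2 + U_(var p p) + U_(var r p))%MM.
  by rewrite m1E -!addmA; congr (_ + _)%MM; rewrite addmC.
rewrite mcoeff_polar mcoeff_gt_mlead ?mul0rn // mE m1E.
have [lt_rp | lt_pr | /val_inj e] := ltngtP r p; last by rewrite e eqxx in nrp.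
  have : mlead v (var r p) = 0%N.
    by apply: IH => //; [apply: leq_trans lepk|apply: ltn_trans pj jQ].
  by rewrite mE m1E !mnmvE !eqxx addn1 addSn.
exact: ltmc_exchange.
Qed.

Lemma bihighest_content Q v (p : 'I_n) :
    v != 0 -> (forall q r : 'I_n, (q < r)%N -> rowop Q q r v = 0) ->
    (forall i c : 'I_n, (i < c)%N -> (c < Q)%N -> colop i c v = 0) ->
  row_content Q p (mlead v) = if (p < Q)%N then col_content p (mlead v) else 0%N.
Proof.
move=> v0 hrow hcol.
have diag (r c : 'I_n) : (c < Q)%N -> r != c -> mlead v (var r c) = 0%N.
  move=> cQ; rewrite -val_eqE neq_ltn => /orP[]; first exact: (mlead_right v0 hcol).
  exact: (mlead_below v0 hrow).
case: ifP => pQ; last first.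
  rewrite /row_content big1 // => c cQ; apply: diag => //.
  by apply: contraFneq pQ => ->.
rewrite /row_content /col_content (bigD1 p) //= [RHS](bigD1 p) //=.
rewrite !big1 // => [r rp|c /andP[cQ cp]]; first exact: diag.
by apply: diag; rewrite 1?eq_sym.
Qed.
End Operators.

(** * Highest vectors and dominance *)
Section Dominance.
Variables (C : numFieldType) (n : nat).
Implicit Types (p r s i j c k : 'I_n) (m M : 'X_{1..n * n}) (Q : nat).
Implicit Types (f g v w : {mpoly C[n * n]}) (la mu : 'I_n -> nat).

Definition col_highest Q v := forall i j, (i < j)%N -> (j < Q)%N -> colop i j v = 0.
Definition row_highest Q v := forall p r, (p < r)%N -> rowop Q p r v = 0.
Definition row_homog Q mu v :=
  forall m, m \in msupp v -> forall p, row_content Q p m = mu p.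
Definition col_homog Q la v :=
  forall m, m \in msupp v -> forall j, (j < Q)%N -> col_content j m = la j.

(** Raising by a row operator moves the row degrees up in the dominance order,
and it keeps v highest for the columns.  When no raising is possible any more,
the row degrees are the column degrees. *)
Lemma dominance Q v la mu : v != 0 -> col_highest Q v ->
    col_homog Q la v -> row_homog Q mu v ->
  forall t : nat, (\sum_(p < n | (p < t)%N) mu p <=
                   \sum_(p < n | (p < t)%N && (p < Q)%N) la p)%N.
Proof.
have [N leN] := ubnP (\sum_(p < n) p * mu p)%N.
elim: N v mu leN => // N IH v mu; rewrite ltnS => leN v0 vcol vla vmu t.
have [/forallP h|] := boolP
    [forall p : 'I_n, forall r : 'I_n, (p < r)%N ==> (rowop Q p r v == 0)].
  have vrow p r : (p < r)%N -> rowop Q p r v = 0.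
    by have /forallP/(_ r)/implyP h' := h p => /h'/eqP.
  (* no raising is possible: both degrees are read off from the leading monomial *)
  have Mv := mlead_supp v0.
  rewrite [leqRHS]big_mkcondr /=; apply: leq_sum => p _.
  rewrite -(vmu _ Mv) (bihighest_content p v0 vrow vcol).
  by case: ifP => // pQ; rewrite (vla _ Mv).
rewrite negb_forall => /existsP[p]; rewrite negb_forall => /existsP[r].
rewrite negb_imply => /andP[lt_pr v'0].
(* mu' is mu with one unit moved from place r to place p *)
pose mu' s := (mu s - (r == s) + (p == s))%N.
have suppv' m : m \in msupp (rowop Q p r v) -> exists2 c : 'I_n, (c < Q)%N &
   exists2 m', m = (m' + U_(var p c))%MM & (m' + U_(var r c))%MM \in msupp v.
  exact: msupp_rowop.
have mu_r : (0 < mu r)%N.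
  have [c cQ [m' _ /vmu <-]] := suppv' _ (mlead_supp v'0).
  by rewrite row_contentD row_contentU eqxx cQ addn1.
have mu'E s : (mu' s + (r == s) = mu s + (p == s))%N.
  rewrite /mu'; case: (eqVneq r s) => [e|_]; last by rewrite subn0 addn0.
  by rewrite addnAC subnK // -e.
have lt_sum : (\sum_(s < n) s * mu' s < \sum_(s < n) s * mu s)%N.
  have delta (i : 'I_n) : (\sum_(s < n) s * (i == s) = i)%N.
    rewrite (bigD1 i) //= eqxx muln1 big1 ?addn0 // => s /negPf.
    by rewrite eq_sym => ->; rewrite muln0.
  rewrite -(ltn_add2r r) -{1}(delta r) -big_split /=.
  under eq_bigr do rewrite -mulnDr mu'E mulnDr.
  by rewrite big_split /= delta ltn_add2l.
apply: leq_trans (_ : _ <= \sum_(s < n | (s < t)%N) mu' s)%N _.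
  rewrite -(leq_add2r (r < t)%N).
  have delta (i : 'I_n) : ((i < t) = \sum_(s < n | (s < t)%N) (i == s) :> nat)%N.
    case: (ltnP i t) => it; last first.
      by rewrite big1 // => s st; case: eqVneq => // e; rewrite e leqNgt st in it.
    rewrite (bigD1 i) //= eqxx big1 ?addn0 // => s /andP[_ /negPf].
    by rewrite eq_sym => ->.
  rewrite [in leqRHS](delta r) -[leqRHS]big_split /=.
  rewrite (eq_bigr _ (fun s _ => mu'E s)) big_split -delta leq_add2l.
  by case: (ltnP r t) => // rt; rewrite (ltn_trans lt_pr rt).
apply: (IH (rowop Q p r v)) => //.
- exact: leq_trans lt_sum leN.
- move=> i j ij jQ; rewrite colop_rowop ?vcol ?raddf0 //.
  exact: ltn_trans jQ.
- move=> m /suppv'[c cQ [m' -> /vla h]] j /h <-.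
  by rewrite !col_contentD !col_contentU.
- move=> m /suppv'[c cQ [m' -> /vmu h]] s.
  apply: (@addIn (r == s)); rewrite mu'E -h !row_contentD !row_contentU cQ !andbT.
  by rewrite addnAC.
Qed.

(** How two nonzero vectors of one irreducible gl_Q-module are used: an operator
that commutes with gl_Q cannot tell them apart ([same_annihilators_irr]). *)
Definition same_annihilators Q g w :=
  forall T : {linear {mpoly C[n * n]} -> {mpoly C[n * n]}},
    (forall i j f, (i < Q)%N -> (j < Q)%N -> T (colop i j f) = colop i j (T f)) ->
  (T g = 0 <-> T w = 0).

Definition agree Q M : pred 'X_{1..n * n} := fun m =>
  [forall p : 'I_n, forall c : 'I_n, (Q <= c)%N ==> (m (var p c) == M (var p c))].

(** On polynomials with fixed degrees in all rows the second condition follows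
from the first ([fiber_homog]).  It is there because the extraction is also
applied to highest vectors, whose extracted terms should have known row
degrees. *)
Definition fiber Q M : pred 'X_{1..n * n} := fun m =>
  agree Q M m && [forall p : 'I_n, row_content Q p m == row_content Q p M].

Lemma agreeP Q M m :
  reflect (forall p c, (Q <= c)%N -> m (var p c) = M (var p c)) (agree Q M m).
Proof.
apply: (iffP forallP) => [h p c Qc|h p].
  by have /forallP/(_ c)/implyP/(_ Qc)/eqP := h p.
by apply/forallP => c; apply/implyP => /h ->.
Qed.

Lemma agree_inv Q M p r i j m : (i < Q)%N -> (j < Q)%N ->
  agree Q M (m + U_(var p i))%MM = agree Q M (m + U_(var r j))%MM.
Proof.
move=> iQ jQ; suff {p r i j iQ jQ} H p i : (i < Q)%N ->
  agree Q M (m + U_(var p i))%MM = agree Q M m by rewrite !H.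
move=> iQ; apply/agreeP/agreeP => h r c Qc; rewrite -h //;
  rewrite !mnmvE; case: (eqVneq i c) => [e|_]; rewrite ?andbF ?addn0 //;
  by rewrite e ltnNge Qc in iQ.
Qed.

Lemma fiber_inv Q M : col_invariant Q (fiber Q M).
Proof.
move=> p i j iQ jQ m; rewrite /fiber (agree_inv M p p m iQ jQ); congr (_ && _).
by apply: eq_forallb => s; rewrite !row_contentD !row_contentU iQ jQ.
Qed.

Lemma row_content_split Q p m :
  row_content n p m = (row_content Q p m + \sum_(c < n | (Q <= c)%N) m (var p c))%N.
Proof.
rewrite /row_content (bigID (fun c : 'I_n => (c < Q)%N)) /=; congr addn.
  by apply: eq_bigl => c; rewrite ltn_ord.
by apply: eq_bigl => c; rewrite ltn_ord -leqNgt.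
Qed.

Lemma fiber_homog Q M f mu : row_homog n mu f -> M \in msupp f ->
  mproj (fiber Q M) f = mproj (agree Q M) f.
Proof.
move=> fmu fM; apply/mpolyP => m; rewrite !mcoeff_mproj /fiber.
case: (boolP (m \in msupp f)) => [fm|/memN_msupp_eq0 ->]; last by rewrite !if_same.
case: agreeP => //= h; case: forallP => // -[] p; apply/eqP.
apply: (@addIn (\sum_(c < n | (Q <= c)%N) M (var p c))).
rewrite -row_content_split (fmu _ fM) -(fmu _ fm) (row_content_split Q); congr addn.
by apply: eq_bigr => c /h ->.
Qed.

Lemma col_eigen_homog Q la v : (forall j, (j < Q)%N -> colop j j v = v *+ la j) ->
  col_homog Q la v.
Proof.
move=> h m vm j jQ; move/(congr1 (mcoeff m)): (h j jQ).
rewrite mcoeff_colop_diag mcoeffMn => /eqP; move: vm; rewrite mcoeff_msupp => vm.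
by rewrite -[X in X == _]mulr_natr -[X in _ == X]mulr_natr
  (inj_eq (mulfI vm)) eqr_nat => /eqP.
Qed.

Lemma mdeg_row_content m : mdeg m = (\sum_(p < n) row_content n p m)%N.
Proof.
rewrite mdegE big_var; apply: eq_bigr => p _.
by apply: eq_bigl => c; rewrite ltn_ord.
Qed.

End Dominance.

Section Contents.
Variables (C : numFieldType) (n : nat).
Implicit Types (p r s i j c k : 'I_n) (m M : 'X_{1..n * n}) (Q : nat).
Implicit Types (f g v w : {mpoly C[n * n]}) (la mu : 'I_n -> nat).

Lemma msupp_neq0 f m : m \in msupp f -> f != 0.
Proof. by apply: contraTneq => ->; rewrite mcoeff_msupp mcoeff0 eqxx. Qed.

Lemma fiber_refl Q M : fiber Q M M.
Proof. by rewrite /fiber; apply/andP; split; [apply/agreeP | apply/forallP]. Qed.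

Lemma fiber_transfer Q g w M : same_annihilators Q g w -> M \in msupp g ->
  mproj (fiber Q M) w != 0.
Proof.
move=> hT gM; apply: contraTneq gM => Tw0.
have /hT [_ /(_ Tw0)/(congr1 (mcoeff M))] : forall i j f, (i < Q)%N -> (j < Q)%N ->
    mproj (fiber Q M) (colop i j f) = colop i j (mproj (fiber Q M) f).
  by move=> i j f iQ jQ; rewrite (colop_mproj f (@fiber_inv n Q M)).
by rewrite mcoeff_mproj fiber_refl mcoeff0 mcoeff_msupp => ->; rewrite eqxx.
Qed.

Lemma fiber_row_homog Q M f :
  row_homog Q (fun p => row_content Q p M) (mproj (fiber Q M) f).
Proof.
move=> m; rewrite msupp_mproj => /andP[/andP[_ /forallP h] _] p.
exact/eqP.
Qed.

Lemma fiber_col_homog Q M f la : col_homog Q la f ->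
  col_homog Q la (mproj (fiber Q M) f).
Proof. by move=> h m; rewrite msupp_mproj => /andP[_]; apply: h. Qed.

Lemma fiber_col_highest Q M f : col_highest Q f -> col_highest Q (mproj (fiber Q M) f).
Proof.
move=> h i j ij jQ; rewrite (colop_mproj f (@fiber_inv n Q M)) ?h ?raddf0 //.
exact: ltn_trans jQ.
Qed.

(** [dominance] applied to the part of w extracted by the fiber of M. *)
Lemma content_dominated Q g w la M : same_annihilators Q g w ->
    col_highest Q w -> col_homog Q la w -> M \in msupp g ->
  (forall t : nat, (\sum_(p < n | (p < t)%N) row_content Q p M <=
                    \sum_(p < n | (p < t)%N && (p < Q)%N) la p)%N) /\
  (\sum_(p < n) row_content Q p M = \sum_(p < n | (p < Q)%N) la p)%N.
Proof.
move=> hT hw lw gM; have v0 := fiber_transfer hT gM.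
have vrow := @fiber_row_homog Q M w; have vcol := fiber_col_homog (M := M) lw.
split; first exact: dominance v0 (fiber_col_highest M hw) vcol vrow.
have Mv := mlead_supp v0; under eq_bigr do rewrite -(vrow _ Mv).
rewrite sum_row_content; apply: eq_bigr => j; exact: vcol Mv j.
Qed.

(** The row operator on all columns kills g.  The operators of the columns from
Q on contribute to the terms of the fiber only from monomials with one more
entry in row r, instead of row p < r, of such a column; these are larger than
the leading one. *)
Lemma rowop_fiber_mlead Q g mu p r : g != 0 -> row_homog n mu g ->
    row_highest n g -> (p < r)%N ->
  rowop Q p r (mproj (fiber Q (mlead g)) g) = 0.
Proof.
move=> g0 gmu grow lt_pr; set M := mlead g.
rewrite (fiber_homog Q gmu (mlead_supp g0)).
have -> : rowop Q p r (mproj (agree Q M) g) = mproj (agree Q M) (rowop Q p r g).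
  rewrite /rowop raddf_sum /=; apply: eq_bigr => c cQ.
  by rewrite (mproj_polar (P' := agree Q M)) // => m; apply: agree_inv.
have : rowop Q p r g = - \sum_(c < n | (Q <= c)%N) polar (var p c) (var r c) g.
  apply/eqP; rewrite -addr_eq0 -[X in _ == X](grow _ _ lt_pr) /rowop.
  rewrite [X in _ == X](bigID (fun c : 'I_n => (c < Q)%N)) /=.
  apply/eqP; congr (_ + _); apply: eq_bigl => c; rewrite ltn_ord //.
  by rewrite -leqNgt.
move=> ->; rewrite raddfN /= (raddf_sum (mproj (agree Q M))) /= big1 ?oppr0 // => c Qc.
apply/mpolyP => m; rewrite mcoeff_mproj mcoeff0; case: agreeP => // mM.
apply/eqP; rewrite mcoeff_eq0; apply/negP => /msupp_polar[k mE gk].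
have := msupp_le_mlead gk; rewrite leNgt => /negP; apply.
apply: (@ltmc_var _ _ _ r c).
- rewrite !mdeg_row_content; apply: eq_bigr => s _.
  by rewrite (gmu _ gk) (gmu _ (mlead_supp g0)).
- move=> s d h; rewrite -/M -mM ?mE ?mnmvE.
    by move: h lt_pr; rewrite -!val_eqE /=; do ?case: eqP => //=; lia.
  by move: h Qc; rewrite -val_eqE /=; lia.
- by rewrite -/M -mM // mE !mnmvE !eqxx andbT -val_eqE /= (ltn_eqF lt_pr) addn0 addn1.
Qed.

(** By [rowop_fiber_mlead] the extracted part of g is highest for the rows, so
that of w is highest for rows and columns. *)
Lemma content_mlead Q g w la mu : g != 0 -> row_homog n mu g -> row_highest n g ->
    same_annihilators Q g w -> col_highest Q w -> col_homog Q la w ->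
  forall p, row_content Q p (mlead g) = if (p < Q)%N then la p else 0%N.
Proof.
move=> g0 gmu grow hT hw lw p; set M := mlead g.
have gM : M \in msupp g := mlead_supp g0.
have v0 := fiber_transfer hT gM; set v := mproj _ w in v0.
have vrow : row_highest Q v.
  move=> q r lt_qr.
  have /hT [h _] : forall i j f, (i < Q)%N -> (j < Q)%N ->
    (rowop Q q r \o mproj (fiber Q M)) (colop i j f) =
    colop i j ((rowop Q q r \o mproj (fiber Q M)) f).
    move=> i j f iQ jQ /=.
    by rewrite -(colop_mproj f (@fiber_inv n Q M)) // colop_rowop.
  exact/h/(rowop_fiber_mlead _ g0 gmu).
rewrite -(@fiber_row_homog Q M w _ (mlead_supp v0)).
rewrite (bihighest_content p v0 vrow (fiber_col_highest M hw)).
by case: ifP => // pQ; exact: (fiber_col_homog (M := M) lw (mlead_supp v0) pQ).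
Qed.

End Contents.

(** * Interlacing of contents *)
Section SL2.
Variables (C : numClosedFieldType) (n : nat).
Implicit Types (p r s i j c k : 'I_n) (m M : 'X_{1..n * n}) (Q : nat).
Implicit Types (f g h : {mpoly C[n * n]}).

Lemma fischer_suml (I : Type) (e : seq I) (P : pred I) (G : I -> {mpoly C[n * n]}) f :
  fischer (\sum_(i <- e | P i) G i) f = \sum_(i <- e | P i) fischer (G i) f.
Proof.
rewrite /fischer exchange_big; apply: eq_bigr => m _ /=.
by rewrite raddf_sum rmorph_sum /= mulr_suml mulr_sumr.
Qed.

Lemma fischer_rowop Q p r f g :
  fischer g (rowop Q p r f) = fischer (rowop Q r p g) f.
Proof.
rewrite /rowop raddf_sum fischer_suml; apply: eq_bigr => c _.
exact: fischer_polar.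
Qed.

Lemma iter_rowop_content Q p r h u v (j : nat) m : p != r ->
    (forall m, m \in msupp h -> row_content Q p m = u /\ row_content Q r m = v) ->
    m \in msupp (iter j (rowop Q r p) h) ->
  (row_content Q p m + j = u)%N /\ row_content Q r m = (v + j)%N.
Proof.
move=> neq_pr hh; elim: j m => [|j IH] m /=; first by move=> /hh; rewrite !addn0.
case/msupp_rowop => c cQ [k -> /IH].
rewrite !row_contentD !row_contentU cQ !eqxx (negPf neq_pr) (eq_sym r p).
rewrite (negPf neq_pr) /=.
by move=> [<- e]; split; lia.
Qed.

(** The usual identity e f^(j+1) h = (j + 1) (k - j) f^j h for a highest vector h
of weight k = u - v. *)
Lemma rowop_raise_lower Q p r h u v (j : nat) : p != r ->
    (forall m, m \in msupp h -> row_content Q p m = u /\ row_content Q r m = v) ->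
    rowop Q p r h = 0 ->
  rowop Q p r (iter j.+1 (rowop Q r p) h) =
  (j.+1%:R * (u%:R - v%:R - j%:R)) *: iter j (rowop Q r p) h.
Proof.
move=> neq_pr hh h0.
have wt (i : nat) :
    rowop Q p p (iter i (rowop Q r p) h) - rowop Q r r (iter i (rowop Q r p) h)
    = (u%:R - v%:R - i.*2%:R) *: iter i (rowop Q r p) h.
  apply/mpolyP => m; rewrite mcoeffB mcoeffZ !mcoeff_rowop_diag.
  set fi := iter i _ _.
  case: (boolP (m \in msupp fi)) => [|/memN_msupp_eq0 ->]; last first.
    by rewrite !mul0rn mulr0 subrr.
  case/(iter_rowop_content neq_pr hh) => <- ->.
  rewrite -[X in X - _]mulr_natl -[X in _ - X]mulr_natl -addnn !natrD; ring.
elim: j => [|j IH].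
  by rewrite /= rowop_lower h0 raddf0 add0r (wt 0%N) mul1r.
rewrite iterS rowop_lower IH (wt j.+1) linearZ /= -iterS -scalerDl.
congr (_ *: _); rewrite -addnn !natrD; ring.
Qed.

(** Raising and lowering are adjoint for the Fischer inner product.  So the
squared norm of f h is k times that of h, which excludes a negative weight k,
and the squared norm of f^(k+1) h is <e f^(k+1) h, f^k h> = 0. *)
Lemma rowop_nilpotent Q p r h u v b : p != r -> h != 0 ->
    (forall m, m \in msupp h -> row_content Q p m = u /\ row_content Q r m = v) ->
    rowop Q p r h = 0 -> (u < v + b)%N ->
  iter b (rowop Q r p) h = 0.
Proof.
move=> neq_pr hn0 hh h0 lt_uvb.
have norm_ge0 f : 0 <= fischer f f.
  apply: sumr_ge0 => m _; rewrite mulrA mulr_ge0 ?ler0n //.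
  exact: mul_conjC_ge0.
have le_vu : (v <= u)%N.
  rewrite leqNgt; apply/negP => lt_uv.
  have := norm_ge0 (rowop Q r p h); rewrite fischer_rowop.
  rewrite (rowop_raise_lower 0 neq_pr hh h0) /= mul1r subr0 fischerZl.
  rewrite rmorphB /= !conjC_nat pmulr_lge0; last first.
    by rewrite lt_def norm_ge0 andbT; apply: contra_neq hn0 => /fischer_def.
  by rewrite subr_ge0 ler_nat leqNgt lt_uv.
have Fk0 : iter (u - v).+1 (rowop Q r p) h = 0.
  apply: fischer_def; rewrite {2}iterS fischer_rowop.
  rewrite (rowop_raise_lower _ neq_pr hh h0) natrB // subrr mulr0 scale0r.
  by rewrite fischer0l.
have -> : b = (b - (u - v).+1 + (u - v).+1)%N by lia.
by rewrite iterD Fk0; elim: (b - _)%N => //= k ->; rewrite raddf0.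
Qed.

End SL2.

Section Interlacing.
Variables (C : numClosedFieldType) (n : nat).
Implicit Types (p r s i j c k q : 'I_n) (m M : 'X_{1..n * n}) (Q : nat).
Implicit Types (f g h : {mpoly C[n * n]}).

(** The monomials that a row operator between the rows p and r, on the columns up
to q, can connect to M, with the total degree of the two entries in column q
fixed. *)
Definition block q p r M : pred 'X_{1..n * n} := fun m =>
  [forall s : 'I_n, forall c : 'I_n,
     ~~ (((s == p) || (s == r)) && (c <= q)%N) ==> (m (var s c) == M (var s c))]
  && (m (var p q) + m (var r q) == M (var p q) + M (var r q))%N.

Lemma blockP q p r M m :
  reflect ((forall s c, ~~ (((s == p) || (s == r)) && (c <= q)%N) ->
              m (var s c) = M (var s c)) /\
           (m (var p q) + m (var r q) = M (var p q) + M (var r q))%N)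
          (block q p r M m).
Proof.
apply: (iffP andP) => -[].
  move=> /forallP h /eqP; split => // s c sc.
  by have /forallP/(_ c)/implyP/(_ sc)/eqP := h s.
move=> h /eqP; split => //; apply/forallP => s; apply/forallP => c.
by apply/implyP => /h ->.
Qed.

Lemma block_inv q p r c M m : p != r -> (c <= q)%N ->
  block q p r M (m + U_(var p c))%MM = block q p r M (m + U_(var r c))%MM.
Proof.
move=> neq_pr cq; rewrite /block !mnmvE !eqxx (negPf neq_pr) (eq_sym r p).
rewrite (negPf neq_pr).
congr (_ && _); last by rewrite !addn0 addnAC addnA.
apply: eq_forallb => s; apply: eq_forallb => d; rewrite !mnmvE.
case: (boolP (((s == p) || (s == r)) && (d <= q)%N)) => //= sd.
have -> : (p == s) && (c == d) = false.
  by apply: contraNF sd => /andP[/eqP<- /eqP<-]; rewrite eqxx cq.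
suff -> : (r == s) && (c == d) = false by [].
by apply: contraNF sd => /andP[/eqP<- /eqP<-]; rewrite eqxx cq orbT.
Qed.

Lemma polar_rowop Q q p r h : (Q <= q)%N -> p != r ->
  polar (var p q) (var r q) (rowop Q p r h) = rowop Q p r (polar (var p q) (var r q) h).
Proof.
move=> Qq neq_pr; rewrite /rowop raddf_sum /=; apply: eq_bigr => c cQ.
rewrite polar_comm !var_eqE (negPf neq_pr) /= !mul0r addr0 subr0 //.
Qed.

Lemma iterC (A : Type) (F G : A -> A) : (forall x, F (G x) = G (F x)) ->
  forall a b x, iter a F (iter b G x) = iter b G (iter a F x).
Proof.
move=> FG a b x; elim: a => //= a ->; elim: b => //= b IH.
by rewrite FG IH.
Qed.

Lemma iterZ (V : lmodType C) (F : {linear V -> V}) (e : nat) a v :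
  iter e F (a *: v) = a *: iter e F v.
Proof. by elim: e => //= e ->; rewrite linearZ. Qed.

Lemma iter0 (V : lmodType C) (F : {linear V -> V}) (e : nat) : iter e F 0 = 0.
Proof. by elim: e => //= e ->; rewrite raddf0. Qed.

Lemma iter_polar_neq0 (x y : 'I_(n * n)) f (e : nat) : x != y -> f != 0 ->
  (forall m, m \in msupp f -> m y = e) -> iter e (polar x y) f != 0.
Proof.
move=> neq_xy; elim: e f => // e IH f f0 fe.
rewrite iterSr; apply: IH.
  have fM := mlead_supp f0; have My : (0 < mlead f y)%N by rewrite (fe _ fM).
  have [k kE] := mnm_subK My.
  apply: contraTneq fM => /(congr1 (mcoeff (k + U_(x))%MM))/eqP.
  by rewrite mcoeff_polar -kE mcoeff0 mulrn_eq0 /= mcoeff_eq0.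
move=> m /msupp_polar[k -> /fe]; rewrite !mnmDE !mnm1E eqxx (negPf neq_xy).
by rewrite addn1 addn0 => -[].
Qed.

(** Let x and y be the entries of the rows p and r = p + 1 in column q, and b the
exponent of y in the leading monomial M.  Collect the terms of f in the block
of M by their exponent e of y into [G e]; none has e > b, as it would be larger
than M.  With E and F the row operators on the columns before q and P the
polarization x d/dy, the highest vector condition reads E (G e) = - P (G (e+1)).
Hence G b is killed by E and, up to a nonzero scalar, E^b (G 0) = P^b (G b).  If
b exceeded the weight of G b, then F^b (G b) = 0 ([rowop_nilpotent]).  As F
commutes with P, also F^b E^b (G 0) = 0, so that E^b (G 0) has norm 0.  But
P^b (G b) is not 0, since y has exponent b in all terms of G b. *)
Lemma mlead_interlace f (mu : 'I_n -> nat) p r q :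
    f != 0 -> row_homog n mu f -> row_highest n f -> r = p.+1 :> nat ->
  (row_content q.+1 r (mlead f) <= row_content q p (mlead f))%N.
Proof.
move=> f0 fmu frow rE; set M := mlead f.
have fM : M \in msupp f := mlead_supp f0.
have lt_pr : (p < r)%N by rewrite rE.
have neq_pr : p != r by rewrite -val_eqE neq_ltn lt_pr.
set x := var p q; set y := var r q; set b := M y.
have neq_xy : x != y by rewrite var_eqE (negPf neq_pr).
have mdegM m : m \in msupp f -> mdeg M = mdeg m.
  move=> fk; rewrite !mdeg_row_content; apply: eq_bigr => s _.
  by rewrite (fmu _ fk) (fmu _ fM).
pose g : {mpoly C[n * n]} := mproj (block q p r M) f.
pose E : {linear {mpoly C[n * n]} -> {mpoly C[n * n]}} := rowop q p r.
pose F : {linear {mpoly C[n * n]} -> {mpoly C[n * n]}} := rowop q r p.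
pose P : {linear {mpoly C[n * n]} -> {mpoly C[n * n]}} := polar x y.
have EP0 : E g = - P g.
  apply/eqP; rewrite -addr_eq0; apply/eqP.
  have -> : E g + P g = mproj (block q p r M) (rowop q.+1 p r f).
    rewrite /E /P /= /rowop (raddf_sum (mproj (block q p r M))) /=.
    rewrite [RHS](bigD1 q) //= [RHS]addrC; congr (_ + _); last first.
      by rewrite /g -(mproj_polar (P := block q p r M)) // => m; apply: block_inv.
    apply: eq_big => [c|c cq]; first by rewrite -val_eqE /=; lia.
    rewrite /g -(mproj_polar (P := block q p r M)) // => m; apply: block_inv => //.
    exact: ltnW.
  have -> : rowop q.+1 p r f = - \sum_(c < n | (q < c)%N) polar (var p c) (var r c) f.
    apply/eqP; rewrite -addr_eq0 -[X in _ == X](frow _ _ lt_pr) /rowop.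
    rewrite [X in _ == X](bigID (fun c : 'I_n => (c < q.+1)%N)) /=.
    apply/eqP; congr (_ + _); apply: eq_bigl => c; rewrite ltn_ord //.
    by rewrite ltnS -ltnNge.
  rewrite raddfN /= (raddf_sum (mproj (block q p r M))) /= big1 ?oppr0 // => c qc.
  apply/mpolyP => m; rewrite mcoeff_mproj mcoeff0; case: blockP => // -[mM _].
  apply/eqP; rewrite mcoeff_eq0; apply/negP => /msupp_polar[k mE fk].
  have := msupp_le_mlead fk; rewrite leNgt => /negP; apply.
  apply: (@ltmc_var _ _ _ r c); first exact: mdegM.
  - move=> s d h; rewrite -/M -mM ?mE ?mnmvE.
      by move: h lt_pr; rewrite -!val_eqE /=; do ?case: eqP => //=; lia.
    by move: h qc; rewrite -val_eqE /=; lia.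
  - rewrite -/M -mM ?mE ?mnmvE ?(negPf neq_pr) ?eqxx ?addn0 ?addn1 //.
    by rewrite negb_and -ltnNge qc orbT.
pose G e := mproj (fun m => m y == e) g.
have EG e : E (G e) = - P (G e.+1).
  have -> : E (G e) = mproj (fun m => m y == e) (E g).
    rewrite /E /= /rowop (raddf_sum (mproj (fun m => m y == e))) /=.
    apply: eq_bigr => c cq.
    rewrite (mproj_polar (P' := fun m => m y == e)) // => m.
    have /negPf cq' : c != q by rewrite -val_eqE neq_ltn cq.
    by rewrite /y !mnmvE cq' !andbF.
  rewrite EP0 raddfN /P /=; congr (- _).
  rewrite (mproj_polar (P' := fun m => m y == e.+1)) // => m.
  by rewrite !mnmDE !mnm1E eqxx (negPf neq_xy) addn0 addn1 eqSS.
(* a term with exponent b + 1 of y would be larger than M *)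
have Gb0 : G b.+1 = 0.
  apply/mpolyP => m; rewrite mcoeff0 /G !mcoeff_mproj; case: eqP => // my.
  case: blockP => // -[mM _]; apply/eqP; rewrite mcoeff_eq0; apply/negP => fm.
  have := msupp_le_mlead fm; rewrite leNgt => /negP; apply.
  apply: (@ltmc_var _ _ _ r q); first exact: mdegM.
    move=> s d h; rewrite -/M mM //; move: h; rewrite -!val_eqE /=.
    move: lt_pr; lia.
  by rewrite -/M -/y my.
have EPC h : E (P h) = P (E h) by rewrite /E /P /= polar_rowop.
have EiG (i : nat) : (i <= b)%N -> exists2 k : C, k != 0 &
    iter i E (G (b - i)%N) = k *: iter i P (G b).
  elim: i => [|i IH] ib; first by exists 1; rewrite ?oner_eq0 // subn0 scale1r.
  have [k k0 IHk] := IH (ltnW ib); exists (- k); first by rewrite oppr_eq0.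
  rewrite iterSr EG subnSK // -scaleN1r (iterZ E) (_ : P _ = iter 1 P (G (b - i)%N)) //.
  by rewrite (iterC EPC) IHk iterZ -iterD add1n scalerA mulN1r.
rewrite leqNgt; apply/negP => lt_b.
have GbM : M \in msupp (G b).
  rewrite /G msupp_mproj eqxx msupp_mproj fM andbT.
  by apply/blockP; split.
have EGb : E (G b) = 0 by rewrite EG Gb0 raddf0 oppr0.
(* the exponents in column q and outside the block are those of M, and so are
   the total degrees of the rows *)
have cont m : m \in msupp (G b) ->
    row_content q p m = row_content q p M /\ row_content q r m = row_content q r M.
  rewrite /G !msupp_mproj => /andP[/eqP my /andP[/blockP[mM xy] fm]].
  have mx : m x = M x by apply: (@addIn (m y)); rewrite xy my.
  have eqmM s c : (s == p) || (s == r) -> (q <= c)%N -> m (var s c) = M (var s c).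
    move=> sp; rewrite leq_eqVlt => /orP[/eqP/val_inj <-|qc].
      by case/orP: sp => /eqP ->.
    by apply: mM; rewrite negb_and -ltnNge qc orbT.
  have eqrow s : (s == p) || (s == r) -> row_content q s m = row_content q s M.
    move=> sp; apply: (@addIn (\sum_(c < n | (q <= c)%N) M (var s c))).
    rewrite -row_content_split (fmu _ fM) -(fmu _ fm) (row_content_split q); congr addn.
    by apply: eq_bigr => c /(eqmM _ _ sp) ->.
  by split; apply: eqrow; rewrite eqxx ?orbT.
have Fb0 : iter b F (G b) = 0.
  apply: rowop_nilpotent neq_pr (msupp_neq0 GbM) cont EGb _.
  suff <- : row_content q.+1 r M = (row_content q r M + b)%N by [].
  rewrite {1}/row_content (bigD1 q) //= addnC; congr addn; apply: eq_bigl => c.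
  by rewrite -val_eqE /=; lia.
have FPC h : F (P h) = P (F h).
  rewrite /F /P /= /rowop (raddf_sum (polar x y)) /=; apply: eq_bigr => c cq.
  rewrite polar_comm !var_eqE.
  have /negPf qc : q != c by rewrite -val_eqE neq_ltn cq orbT.
  by rewrite qc (eq_sym c) qc !andbF !mul0r addr0 subr0.
have [k k0 EbG] := EiG _ (leqnn b).
have FPb0 : iter b F (iter b P (G b)) = 0 by rewrite (iterC FPC) Fb0 iter0.
have adj h h' (i : nat) : fischer h (iter i E h') = fischer (iter i F h) h'.
  by elim: i h => // i IH h; rewrite iterS [LHS]fischer_rowop IH -iterSr.
rewrite subnn in EbG.
have Eb0 : iter b E (G 0%N) = 0.
  by apply: fischer_def; rewrite adj EbG iterZ FPb0 scaler0 fischer0l.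
move/eqP: EbG; rewrite Eb0 eq_sym scaler_eq0 (negPf k0) /=; apply/negP.
apply: iter_polar_neq0 neq_xy (msupp_neq0 GbM) _ => m.
by rewrite /G msupp_mproj => /andP[/eqP].
Qed.

End Interlacing.

(** * Minors *)
Lemma initial_segment N (P : pred 'I_N) :
  (forall a b : 'I_N, (a < b)%N -> P b -> P a) -> forall k, P k = (k < #|P|)%N.
Proof.
move=> Pdown k; have card_lt j : (j <= N)%N -> #|[set l : 'I_N | (l < j)%N]| = j.
  move=> jN; rewrite -sum1dep_card -(big_ord_widen _ (fun=> 1%N)) //.
  by rewrite sum1_card card_ord.
apply/idP/idP => [Pk|].
  rewrite -(card_lt k.+1) //; apply/subset_leq_card/subsetP => l.
  rewrite inE ltnS leq_eqVlt => /orP[/eqP/val_inj -> //|lk]; exact: Pdown Pk.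
apply: contraTT => nPk; rewrite -leqNgt -[leqRHS](card_lt k) ?(ltnW (ltn_ord k)) //.
apply/subset_leq_card/subsetP => l Pl; rewrite inE ltnNge.
apply: contra nPk; rewrite leq_eqVlt => /orP[/eqP/val_inj -> //|kl]; exact: Pdown Pl.
Qed.

Section Derivation.
Variables (R : comNzRingType) (delta : {additive R -> R}).
Hypothesis deltaM : forall x y, delta (x * y) = delta x * y + x * delta y.

Lemma derivation1 : delta 1 = 0.
Proof.
by have := deltaM 1 1; rewrite !mulr1 mul1r -[X in X = _]addr0 => /addrI.
Qed.

Lemma derivation_prod (I : finType) (F : I -> R) :
  delta (\prod_i F i) = \sum_i \prod_k (if k == i then delta (F k) else F k).
Proof.
suff H (s : seq I) : uniq s -> delta (\prod_(i <- s) F i) =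
    \sum_(i <- s) \prod_(k <- s) (if k == i then delta (F k) else F k).
  by rewrite H ?index_enum_uniq.
elim: s => [|a s IH] /=; first by rewrite !big_nil derivation1.
case/andP => as_ us; rewrite !big_cons deltaM IH // eqxx; congr (_ + _).
  congr (_ * _); apply: eq_big_seq => k ks; case: eqP => // ka.
  by rewrite -ka ks in as_.
rewrite mulr_sumr; apply: eq_big_seq => i si; rewrite big_cons; case: eqP => // ai.
by rewrite ai si in as_.
Qed.

Lemma derivation_det k (A : 'M[R]_k) :
  delta (\det A) =
  \sum_i \det (\matrix_(l, j) if l == i then delta (A l j) else A l j).
Proof.
rewrite /determinant raddf_sum exchange_big; apply: eq_bigr => s _ /=.
have -> x : delta ((-1) ^+ odd_perm s * x) = (-1) ^+ odd_perm s * delta x.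
  by case: (odd_perm s); rewrite ?expr0 ?expr1 ?mul1r // !mulN1r raddfN.
rewrite derivation_prod mulr_sumr; apply: eq_bigr => i _; congr (_ * _).
by apply: eq_bigr => l _; rewrite mxE.
Qed.

End Derivation.

Section Minors.
Variables (C : numFieldType) (n : nat).
Implicit Types (p r s i j c : 'I_n) (m K : 'X_{1..n * n}) (Q : nat).
Implicit Types (f g : {mpoly C[n * n]}) (X : {set 'I_n}) (mu : 'I_n -> nat).

Definition generic_mx : 'M[{mpoly C[n * n]}]_n := \matrix_(p, j) 'X_(var p j).

Definition minor X : {mpoly C[n * n]} :=
  \det (mxsub (widen_ord (card_le_n X)) (@enum_val _ (mem X)) generic_mx).

Definition minor_row X (k : 'I_#|X|) : 'I_n := widen_ord (card_le_n X) k.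

Definition minor_mnm X (s : 'S_#|X|) : 'X_{1..n * n} :=
  (\sum_k U_(var (minor_row k) (enum_val (s k))))%MM.

Lemma rowopM Q p r f g :
  rowop Q p r (f * g) = rowop Q p r f * g + f * rowop Q p r g.
Proof.
rewrite /rowop mulr_suml mulr_sumr -big_split; apply: eq_bigr => c _ /=.
by rewrite /polar mderivM; ring.
Qed.

Lemma rowopX Q p r s c :
  rowop Q p r ('X_(var s c) : {mpoly C[n * n]}) =
    if (s == r) && (c < Q)%N then 'X_(var p c) else 0.
Proof.
rewrite /rowop /polar; under eq_bigr do rewrite mderiv_var var_eqE -mulnb natrM.
case: (eqVneq s r) => [_|_] /=; last by rewrite big1 // => d _; rewrite mul0r mulr0.
case: (ltnP c Q) => cQ; last first.
  rewrite big1 // => d dQ; case: eqVneq => [e|_]; last by rewrite !mulr0.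
  by rewrite e leqNgt dQ in cQ.
rewrite (bigD1 c) //= eqxx !mulr1 big1 ?addr0 // => d /andP[_ /negPf].
by rewrite eq_sym => ->; rewrite !mulr0.
Qed.

(** The row operator replaces row r of the minor by row p, which is a row of the
minor already. *)
Lemma row_highest_minor X : row_highest n (minor X).
Proof.
move=> p r lt_pr; rewrite /minor (derivation_det (@rowopM n p r)) big1 // => i _.
case: (eqVneq (minor_row i) r) => [ir|nir].
  have lt_pX : (p < #|X|)%N by apply: ltn_trans lt_pr _; rewrite -ir /= ltn_ord.
  apply: (@determinant_alternate _ _ _ i (Ordinal lt_pX)).
    by apply: contraTneq lt_pr => e; rewrite -ir e /= ltnn.
  move=> l; rewrite !mxE eqxx /=.
  have -> : (Ordinal lt_pX == i) = false.
    by apply: contraTF lt_pr => /eqP e; rewrite -ir -e /= ltnn.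
  rewrite rowopX -/(minor_row i) ir eqxx ltn_ord /=.
  by have -> : widen_ord (card_le_n X) (Ordinal lt_pX) = p by apply: val_inj.
rewrite (expand_det_row _ i) big1 // => l _; rewrite !mxE eqxx /= rowopX.
by rewrite -/(minor_row i) (negPf nir) mul0r.
Qed.

Lemma minorE X : minor X = \sum_(s : 'S_#|X|) (-1) ^+ s *: 'X_[minor_mnm s].
Proof.
rewrite /minor /determinant; apply: eq_bigr => s _.
rewrite /minor_mnm -mprodXE -mul_mpolyC rmorphXn rmorphN1.
by congr (_ * _); apply: eq_bigr => k _; rewrite !mxE.
Qed.

Lemma msupp_minor X m : m \in msupp (minor X) -> exists s : 'S_#|X|, m = minor_mnm s.
Proof.
rewrite minorE => /msupp_sum_le/flattenP[e /mapP[s _ ->]].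
by move=> /msuppZ_le /mem_msuppXP <-; exists s.
Qed.

Lemma row_content_sum Q p (I : finType) (F : I -> 'X_{1..n * n}) :
  row_content Q p (\sum_k F k)%MM = (\sum_k row_content Q p (F k))%N.
Proof.
rewrite /row_content exchange_big; apply: eq_bigr => c _ /=.
by rewrite mnm_sumE.
Qed.

Definition card_below Q X : nat := #|[set j in X | (j < Q)%N]|.

Lemma minor_mnm_content Q p X (s : 'S_#|X|) :
  row_content Q p (minor_mnm s) =
  (\sum_(k < #|X|) ((minor_row k == p) && (enum_val (s k) < Q)))%N.
Proof.
rewrite /minor_mnm row_content_sum; apply: eq_bigr => k _.
exact: row_contentU.
Qed.


Lemma enum_val_below Q X (k : 'I_#|X|) :
  (enum_val k < Q)%N = (k < card_below Q X)%N.
Proof.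
have mono (a b : 'I_#|X|) : (a < b)%N -> (enum_val a < enum_val b)%N.
  move=> ab; have x0 := enum_val a; rewrite !(enum_val_nth x0).
  have := @sorted_ltn_nth _ (fun i j : 'I_n => (i < j)%N) _ x0 (enum X).
  move=> h; apply: h; rewrite ?inE -?cardE //; first by move=> ? ? ?; apply: ltn_trans.
  rewrite {1}/enum_mem; apply: sorted_filter; first by move=> ? ? ?; apply: ltn_trans.
  have : sorted ltn (map val (enum 'I_n)) by rewrite val_enum_ord iota_ltn_sorted.
  by rewrite sorted_map enumT.
have cardE' : card_below Q X = #|[set l : 'I_#|X| | (enum_val l < Q)%N]|.
  rewrite -(card_imset _ (@enum_val_inj _ (mem X))); apply: eq_card => j.
  rewrite !inE; apply/andP/imsetP => [[jX jQ]|[l]]; last first.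
    by rewrite inE => lQ ->; split => //; apply: enum_valP.
  by exists (enum_rank_in jX j); rewrite ?inE enum_rankK_in.
rewrite cardE' (@initial_segment _ (fun l : 'I_#|X| => (enum_val l < Q)%N)).
  by congr (_ < _)%N; apply: eq_card => l; rewrite inE.
by move=> x y /mono/ltn_trans; exact.
Qed.

Lemma leq_card_below Q X : (card_below Q X <= #|X|)%N.
Proof. by apply/subset_leq_card/subsetP => j; rewrite inE => /andP[]. Qed.

Lemma card_belowT X : card_below n X = #|X|.
Proof. by apply: eq_card => j; rewrite inE ltn_ord andbT. Qed.

(** The partial sums that define the dominance order. *)
Definition top_content Q t m : nat := \sum_(s < n | (s < t)%N) row_content Q s m.

Lemma top_contentD Q t m m' :
  top_content Q t (m + m')%MM = (top_content Q t m + top_content Q t m')%N.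
Proof.
by rewrite /top_content -big_split; apply: eq_bigr => s _; rewrite row_contentD.
Qed.

Lemma row_content_inj m m' :
  (forall q p : 'I_n, row_content q.+1 p m = row_content q.+1 p m') -> m = m'.
Proof.
move=> e; apply: mnm_varP => p j.
have rcS M : row_content j.+1 p M = (row_content j p M + M (var p j))%N.
  rewrite /row_content (bigD1 j) //= addnC; congr addn; apply: eq_bigl => c.
  by rewrite -val_eqE /=; lia.
have {e} e q : (q <= n)%N -> row_content q p m = row_content q p m'.
  case: q => [|q]; first by rewrite /row_content !big_pred0.
  by move=> qn; have := e (Ordinal qn) p.
have := e j.+1 (ltn_ord j); rewrite !rcS e ?(ltnW (ltn_ord j)) //.
exact: addnI.
Qed.

Lemma top_content_inj m m' :
  (forall Q t, top_content Q t m = top_content Q t m') -> m = m'.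
Proof.
move=> e; apply: row_content_inj => q p.
have tcS M : top_content q.+1 p.+1 M =
    (top_content q.+1 p M + row_content q.+1 p M)%N.
  rewrite /top_content (bigD1 p) //= addnC; congr addn; apply: eq_bigl => c.
  by rewrite -val_eqE /=; lia.
have := e q.+1 p.+1; rewrite !tcS e; exact: addnI.
Qed.

(** The contents of m are below those of K: the dominance order for each row of
the diagrams. *)
Definition dominated K m :=
  forall Q, (forall t, top_content Q t m <= top_content Q t K)%N /\
            top_content Q n m = top_content Q n K.

Lemma dominated_trans K m m' : dominated K m -> dominated m m' -> dominated K m'.
Proof.
move=> h h' Q; have [le_mK eq_mK] := h Q; have [le_m'm eq_m'm] := h' Q.
by split => [t|]; [apply: leq_trans (le_mK t) | rewrite eq_m'm].
Qed.

Lemma dominated_anti K m : dominated K m -> dominated m K -> m = K.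
Proof.
move=> h h'; apply: top_content_inj => Q t; apply/eqP; rewrite eqn_leq.
by have [-> _] := h Q; have [-> _] := h' Q.
Qed.

Definition leading K f := (forall m, m \in msupp f -> dominated K m) /\ f@_K = 1.

Lemma leading1 : leading 0%MM 1.
Proof.
split; last by rewrite mcoeff1 eqxx.
by move=> m; rewrite msupp1 inE => /eqP ->.
Qed.

(** Contents are additive, so a product of two monomials below K and K' can only
be K K' if the factors are K and K'. *)
Lemma leadingM K K' f g : leading K f -> leading K' g -> leading (K + K')%MM (f * g).
Proof.
move=> [Kf f1] [Kg g1]; split.
  move=> m /msuppM_le /allpairsP[[m1 m2] /= [/Kf h1 /Kg h2 ->]] Q.
  have [le1 eq1] := h1 Q; have [le2 eq2] := h2 Q.
  by split => [t|]; rewrite !top_contentD ?leq_add // eq1 eq2.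
pose f0 := f - 'X_[K]; have -> : f = f0 + 'X_[K] by rewrite subrK.
have e1 : ('X_[K] * g)@_(K + K') = 1 by rewrite -commr_mpolyX mcoeffMX.
rewrite mulrDl mcoeffD e1.
suff -> : (f0 * g)@_(K + K') = 0 by rewrite add0r.
apply/eqP; rewrite mcoeff_eq0; apply/negP => /msuppM_le/allpairsP[[m1 m2] /=].
case=> f0m1 /Kg h2 eqK; have neq_m1K : m1 != K.
  apply: contraTneq f0m1 => ->.
  by rewrite mcoeff_msupp mcoeffB mcoeffX eqxx f1 subrr eqxx.
have h1 : dominated K m1.
  apply: Kf; move: f0m1; rewrite !mcoeff_msupp mcoeffB mcoeffX.
  by rewrite [K == _]eq_sym (negPf neq_m1K) subr0.
case/eqP: neq_m1K; apply: top_content_inj => Q t.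
have [le1 _] := h1 Q; have [le2 _] := h2 Q.
have := congr1 (top_content Q t) eqK; rewrite !top_contentD.
by have := le1 t; have := le2 t; lia.
Qed.

Lemma leadingX K f e : leading K f -> leading (K *+ e)%MM (f ^+ e).
Proof.
move=> h; elim: e => [|e IH]; first by rewrite expr0 mulm0n; apply: leading1.
by rewrite exprS mulmS; apply: leadingM.
Qed.

Lemma leading_prod (I : Type) (s : seq I) (K : I -> 'X_{1..n * n})
    (F : I -> {mpoly C[n * n]}) : (forall x, leading (K x) (F x)) ->
  leading (\sum_(i <- s) K i)%MM (\prod_(i <- s) F i).
Proof.
move=> h; elim: s => [|a s IH]; first by rewrite !big_nil; apply: leading1.
by rewrite !big_cons; apply: leadingM.
Qed.

Definition minor_lead X := @minor_mnm X 1%g.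

Lemma minor_lead_content Q p X :
  row_content Q p (minor_lead X) = (p < card_below Q X)%N.
Proof.
rewrite minor_mnm_content; under eq_bigr do rewrite perm1 enum_val_below.
case: (ltnP p #|X|) => pX; last first.
  rewrite ltnNge (leq_trans (leq_card_below Q X) pX) big1 // => k _.
  case: eqVneq => // e; have := ltn_ord k.
  by rewrite -[X in (X < _)%N]/(minor_row k : nat) e ltnNge pX.
rewrite (bigD1 (Ordinal pX)) //= (_ : minor_row _ == p) ?andTb; last exact/eqP/val_inj.
rewrite big1 ?addn0 // => k; case: (eqVneq (minor_row k) p) => // e.
by case/eqP; apply: val_inj; rewrite /= -e.
Qed.

Lemma sum_ord_lt (N a : nat) : (\sum_(s < N) (s < a) = minn N a)%N.
Proof.
elim: N => [|N IH]; first by rewrite big_ord0 min0n.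
by rewrite big_ord_recr /= IH; case: ltnP; lia.
Qed.

(** The monomial of a permutation s uses one entry in each column of X.  Those in
the first t rows and the first Q columns number at most t and at most
[card_below Q X]; on the diagonal their number is the minimum of the two (and of
the size of X). *)
Lemma leading_minor X : leading (minor_lead X) (minor X).
Proof.
have top_minor (s : 'S_#|X|) Q t : top_content Q t (minor_mnm s) =
    (\sum_(k < #|X|) ((k < t) && (enum_val (s k) < Q)))%N.
  rewrite /top_content; under eq_bigr do rewrite minor_mnm_content.
  rewrite exchange_big; apply: eq_bigr => k _ /=.
  case: (ltnP k t) => kt; last first.
    rewrite big1 // => p pt; case: eqVneq => // e.
    by move: pt; rewrite -e /= ltnNge kt.
  rewrite (bigD1 (minor_row k)) //= eqxx big1 ?addn0 // => p /andP[_ /negPf].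
  by rewrite eq_sym => ->.
have total (s : 'S_#|X|) Q :
    (\sum_(k < #|X|) (enum_val (s k) < Q) = card_below Q X)%N.
  transitivity (\sum_(k < #|X|) (enum_val k < Q))%N.
    by rewrite [RHS](reindex_inj (@perm_inj _ s)).
  under eq_bigr do rewrite enum_val_below.
  by rewrite sum_ord_lt; apply/minn_idPr/leq_card_below.
split.
  move=> m /msupp_minor[s ->] Q; split => [t|].
    have -> : top_content Q t (minor_lead X) = minn #|X| (minn t (card_below Q X)).
      rewrite top_minor -sum_ord_lt; apply: eq_bigr => k _.
      by rewrite perm1 enum_val_below leq_min.
    rewrite !leq_min; apply/and3P; split.
    - rewrite top_minor; apply: leq_trans (_ : _ <= \sum_(k < #|X|) 1)%N _.
        by apply: leq_sum => k _; case: (_ && _).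
      by rewrite sum1_card card_ord.
    - rewrite top_minor; apply: leq_trans (_ : _ <= \sum_(k < #|X|) (k < t))%N _.
        by apply: leq_sum => k _; case: (k < t)%N; case: (_ < _)%N.
      by rewrite sum_ord_lt geq_minr.
    - rewrite top_minor -(total s); apply: leq_sum => k _.
      by case: (k < t)%N; case: (_ < _)%N.
  have tk (k : 'I_#|X|) : (k < n)%N by apply: leq_trans (ltn_ord k) (card_le_n X).
  rewrite !top_minor.
  transitivity (card_below Q X); [rewrite -(total s)|rewrite -(total 1%g)];
    by apply: eq_bigr => k _; rewrite tk.
rewrite minorE raddf_sum (bigD1 (1%g : {perm _})) //=.
rewrite mcoeffZ mcoeffX eqxx odd_perm1 mul1r.
rewrite big1 ?addr0 // => s /negPf s1; rewrite mcoeffZ mcoeffX.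
case: eqP => [e|]; last by rewrite mulr0.
suff : s = 1%g by move=> s1'; rewrite s1' eqxx in s1.
apply/permP => k; rewrite perm1; apply/eqP/negPn/negP => sk.
have : minor_lead X (var (minor_row k) (enum_val (s k))) = 0%N.
  rewrite /minor_lead /minor_mnm mnm_sumE big1 // => l _.
  rewrite mnmU_var perm1 (inj_eq enum_val_inj).
  case: (eqVneq l k) => [->|lk]; first by rewrite [k == _]eq_sym (negPf sk) andbF.
  by case: eqP => // /(congr1 val) /= /val_inj e'; rewrite e' eqxx in lk.
by rewrite -e /minor_mnm mnm_sumE (bigD1 k) //= mnmU_var !eqxx.
Qed.
End Minors.

(** * Left highest polynomials and their expansion *)
Section LeftHighest.
Variables (C : numFieldType) (n : nat).
Implicit Types (p r s i j c : 'I_n) (m K : 'X_{1..n * n}) (Q : nat).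
Implicit Types (f g : {mpoly C[n * n]}) (X : {set 'I_n}) (mu : 'I_n -> nat).

(** The space S of the introduction, with mu for the degrees in the rows. *)
Definition left_highest mu f := row_highest n f /\ row_homog n mu f.

Lemma left_highest1 : left_highest (fun=> 0%N) 1.
Proof.
split=> [p r _|m].
  by rewrite /rowop big1 // => c _; rewrite /polar -mpolyC1 mderivC mulr0.
rewrite msupp1 inE => /eqP -> p; rewrite /row_content big1 // => c _.
exact: mnm0E.
Qed.

Lemma left_highestM mu mu' f g : left_highest mu f -> left_highest mu' g ->
  left_highest (fun p => mu p + mu' p)%N (f * g).
Proof.
move=> [f0 fmu] [g0 gmu]; split => [p r pr|m].
  by rewrite rowopM f0 // g0 // mul0r mulr0 addr0.
case/msuppM_le/allpairsP => -[m1 m2] /= [/fmu h1 /gmu h2 ->] p.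
by rewrite row_contentD h1 h2.
Qed.

Lemma left_highestX mu f e : left_highest mu f ->
  left_highest (fun p => e * mu p)%N (f ^+ e).
Proof.
move=> h; elim: e => [|e IH]; first by rewrite expr0; apply: left_highest1.
by rewrite exprS; apply: left_highestM.
Qed.

Lemma left_highest_prod (I : Type) (s : seq I) (P : pred I) (mu : I -> 'I_n -> nat)
    (F : I -> {mpoly C[n * n]}) : (forall x, P x -> left_highest (mu x) (F x)) ->
  left_highest (fun p => \sum_(x <- s | P x) mu x p)%N (\prod_(x <- s | P x) F x).
Proof.
move=> h; elim: s => [|a s IH].
  rewrite big_nil; have [h1 h2] := left_highest1; split=> // m /h2 e p.
  by rewrite big_nil e.
rewrite big_cons; case: (boolP (P a)) => Pa; last first.
  case: IH => h1 h2; split=> // m /h2 e p; by rewrite big_cons (negPf Pa) e.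
have [h1 h2] := left_highestM (h a Pa) IH; split=> // m /h2 e p.
by rewrite big_cons Pa e.
Qed.

Lemma left_highest_minor X : left_highest (fun p => p < #|X|)%N (minor C X).
Proof.
split; first exact: row_highest_minor.
move=> m /msupp_minor[s ->] p.
have -> : row_content n p (minor_mnm s) = row_content n p (minor_lead X).
  rewrite !minor_mnm_content; apply: eq_bigr => k _.
  by rewrite !ltn_ord.
by rewrite minor_lead_content card_belowT.
Qed.

Lemma left_highest0 mu : left_highest mu 0.
Proof. by split=> [p r _|m]; rewrite ?raddf0 // mcoeff_msupp mcoeff0 eqxx. Qed.

Lemma left_highest_lin mu a f g : left_highest mu f -> left_highest mu g ->
  left_highest mu (a *: f + g).
Proof.
move=> [f0 fmu] [g0 gmu]; split=> [p r pr|m].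
  by rewrite linearP /= f0 // g0 // scaler0 addr0.
by move/msuppD_le; rewrite mem_cat => /orP[/msuppZ_le/fmu|/gmu].
Qed.

Lemma left_highest_colop mu i j f : left_highest mu f -> left_highest mu (colop i j f).
Proof.
move=> [f0 fmu]; split=> [p r pr|m].
  by rewrite -colop_rowop ?f0 ?raddf0.
case/msupp_colop => p [k -> /fmu h] r.
by rewrite -h !row_contentD !row_contentU !ltn_ord.
Qed.

Lemma eq_left_highest mu mu' f : mu =1 mu' -> left_highest mu f -> left_highest mu' f.
Proof. by move=> e [h1 h2]; split=> // m /h2 h p; rewrite h. Qed.

End LeftHighest.

Section Triangular.
Variables (C : numFieldType) (n : nat) (mu : 'I_n -> nat).
Variables (I : eqType) (adm : I -> Prop) (g : I -> {mpoly C[n * n]}).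
Hypothesis g_highest : forall D, adm D -> left_highest mu (g D).
Hypothesis g_neq0 : forall D, adm D -> g D != 0.
Hypothesis g_dominated : forall D, adm D ->
  forall m, m \in msupp (g D) -> dominated (mlead (g D)) m.
Hypothesis lead_adm : forall f : {mpoly C[n * n]}, f != 0 -> left_highest mu f ->
  exists2 D, adm D & mlead (g D) = mlead f.
Hypothesis lead_inj : forall D D', adm D -> adm D' ->
  mlead (g D) = mlead (g D') -> D = D'.

(** Induction on the leading monomial.  The multiple of [g D] that cancels it has
all its monomials below it, hence below K. *)
Lemma expansion K (f : {mpoly C[n * n]}) : left_highest mu f ->
    (forall m, m \in msupp f -> dominated K m) ->
  exists s : seq I, exists c : I -> C,
  [/\ uniq s,
      forall D, D \in s ->
        [/\ adm D, dominated K (mlead (g D)) & (mlead (g D) <= mlead f)%O] &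
      f = \sum_(D <- s) c D *: g D].
Proof.
elim/(well_founded_ind (@ltom_wf (n * n))): {f}(mlead f) {-2}f (erefl (mlead f)).
move=> M IH f fM fmu fK.
have [->|f0] := eqVneq f 0.
  by exists [::], (fun=> 0); split=> //; rewrite big_nil.
have [D Dadm gD] := lead_adm f0 fmu.
have fMs : M \in msupp f by rewrite -fM mlead_supp.
have gM : (g D)@_M != 0 by rewrite -fM -gD mleadc_eq0 g_neq0.
(* a is chosen to cancel the leading monomial *)
pose a := f@_M / (g D)@_M; pose f' := (- a) *: g D + f.
have f'mu : left_highest mu f' by apply: left_highest_lin => //; apply: g_highest.
have f'K m : m \in msupp f' -> dominated K m.
  move/msuppD_le; rewrite mem_cat => /orP[/msuppZ_le/(g_dominated Dadm)|/fK //].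
  by rewrite gD fM; apply: dominated_trans; apply: fK.
have fE : f = a *: g D + f' by rewrite /f' scaleNr addNKr.
have [f'0|f'0] := eqVneq f' 0.
  exists [:: D], (fun=> a); split=> //; last by rewrite big_seq1 [LHS]fE f'0 addr0.
  by move=> D'; rewrite inE => /eqP ->; rewrite gD fM; split=> //; apply: fK.
have lt_f'M : (mlead f' < M)%O.
  have f'M : f'@_M = 0 by rewrite /f' mcoeffD mcoeffZ mulNr divfK // addNr.
  rewrite lt_neqAle; apply/andP; split.
    by apply: contra_neq f'0 => e; apply/eqP; rewrite -mleadc_eq0 e f'M.
  have := mlead_supp f'0 => /msuppD_le; rewrite mem_cat => /orP[/msuppZ_le|].
    by move/msupp_le_mlead; rewrite gD fM.
  by move/msupp_le_mlead; rewrite fM.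
have [s [c [us sP f'E]]] := IH _ lt_f'M f' (erefl _) f'mu f'K.
have Ds : D \notin s.
  apply/negP => /sP[_ _]; rewrite gD fM leNgt lt_f'M //.
exists (D :: s), (fun D' => if D' == D then a else c D'); split.
- by rewrite /= Ds.
- move=> D'; rewrite inE => /predU1P[->|/sP[h1 h2 h3]].
    by rewrite gD fM; split=> //; apply: fK.
  by split=> //; apply: le_trans h3 _; rewrite fM ltW.
- rewrite big_cons eqxx [LHS]fE {1}f'E; congr (_ + _); apply: eq_big_seq => D' D's.
  by case: eqP => // e; rewrite -e D's in Ds.
Qed.

(** Among the vectors of the expansion only [g D0] can contain its own leading
monomial: another one has that monomial below its own leading monomial, which
in turn is below it. *)
Lemma triangular_expansion D0 (f : {mpoly C[n * n]}) : adm D0 -> left_highest mu f ->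
    (forall m, m \in msupp f -> dominated (mlead (g D0)) m) ->
    f@_(mlead (g D0)) != 0 ->
  exists s : seq I, exists c : I -> C,
  [/\ uniq s,
      forall D, D \in s -> adm D /\ dominated (mlead (g D0)) (mlead (g D)),
      D0 \in s /\ c D0 != 0 &
      f = \sum_(D <- s) c D *: g D].
Proof.
move=> D0adm fmu fK fD0; have [s [c [us sP fE]]] := expansion fmu fK.
exists s, c; split=> //; first by move=> D /sP[].
suff : D0 \in [seq D <- s | c D != 0] by rewrite mem_filter => /andP[].
apply: contraNT fD0 => nD0; rewrite {1}fE raddf_sum /= big1_seq // => D /andP[_ Ds].
rewrite mcoeffZ; case: (eqVneq (c D) 0) => [->|cD]; first by rewrite mul0r.
have [Dadm KD _] := sP _ Ds.
apply/eqP; rewrite mulf_eq0; apply/orP; right; rewrite mcoeff_eq0.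
apply: contra nD0 => /(g_dominated Dadm) DK.
have -> : D0 = D by apply: lead_inj => //; rewrite (dominated_anti DK KD).
by rewrite mem_filter cD.
Qed.

End Triangular.

(** * Fillings of a diagram by columns *)
Lemma leq_sum_shift n (a b : 'I_n -> nat) : (forall p, a p <= 1)%N ->
    (forall p r : 'I_n, r = p.+1 :> nat -> a r <= b p)%N ->
  (\sum_p a p <= (\sum_p b p).+1)%N.
Proof.
case: n a b => [a b _ _|n a b a1 ab]; first by rewrite big_ord0.
rewrite big_ord_recl [in leqRHS]big_ord_recr /= -[leqRHS]add1n leq_add //.
by apply: leq_trans (leq_addr _ _); apply: leq_sum => p _; apply: ab.
Qed.

(** E p Q is the entry of a diagram in row p and for the first Q columns.  The k-th
column of the corresponding tableau, numbered from 0, has [height k Q] entries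
among the first Q indices.  Interlacing says that this number grows by at most
one with Q; the column consists of the indices where it grows. *)
Section Filling.
Variables (n : nat) (E : 'I_n -> nat -> nat).
Implicit Types (p r q : 'I_n) (Q k : nat).
Hypothesis E0 : forall p, E p 0 = 0%N.
Hypothesis E_col : forall p Q, (Q < n)%N -> (E p Q <= E p Q.+1)%N.
Hypothesis E_diag : forall p r Q, (Q < n)%N -> r = p.+1 :> nat ->
  (E r Q.+1 <= E p Q)%N.

Definition height k Q : nat := \sum_(p < n) (k < E p Q).
Definition filling_col k : {set 'I_n} :=
  [set q : 'I_n | (height k q < height k q.+1)%N].

Lemma height_step k Q : (Q < n)%N ->
  (height k Q <= height k Q.+1 <= (height k Q).+1)%N.
Proof.
move=> Qn; apply/andP; split.
  by apply: leq_sum => p _; case: ltnP => // kE; rewrite (leq_trans kE) // E_col.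
apply: leq_sum_shift => [p|p r rE]; first by case: (_ < _)%N.
by case: ltnP => // kE; rewrite (leq_trans kE) //; exact: E_diag.
Qed.

Lemma card_belowS Q (X : {set 'I_n}) (Qn : (Q < n)%N) :
  card_below Q.+1 X = (card_below Q X + (Ordinal Qn \in X))%N.
Proof.
have cbE R : card_below R X = (\sum_(j < n) ((j \in X) && (j < R)))%N.
  rewrite /card_below -sum1dep_card big_mkcond; apply: eq_bigr => j _.
  by case: (_ && _).
rewrite !cbE (bigD1 (Ordinal Qn)) //= [in RHS](bigD1 (Ordinal Qn)) //=.
rewrite ltnSn ltnn andbT andbF add0n addnC; congr addn.
by apply: eq_bigr => j; rewrite -val_eqE /= ltnS [in RHS]ltn_neqAle => ->.
Qed.

Lemma card_below_filling k Q : (Q <= n)%N ->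
  card_below Q (filling_col k) = height k Q.
Proof.
elim: Q => [|Q IH] Qn.
  rewrite /card_below /height big1 => [|p _]; last by rewrite E0.
  by apply/eqP; rewrite cards_eq0; apply/eqP/setP => j; rewrite !inE andbF.
rewrite (card_belowS _ Qn) IH ?(ltnW Qn) // inE /=.
by have /andP[] := height_step k Qn; case: ltnP; lia.
Qed.

Lemma filling_row_le p r Q : (Q <= n)%N -> (p < r)%N -> (E r Q <= E p Q)%N.
Proof.
move=> Qn; case: r => r lt_rn /=; elim: r lt_rn => // r IH lt_rn; rewrite ltnS => le_pr.
have lt_rn' : (r < n)%N by apply: ltnW.
have step : (E (Ordinal lt_rn) Q <= E (Ordinal lt_rn') Q)%N.
  case: Q Qn {IH} => [|Q] Qn; first by rewrite !E0.
  by apply: leq_trans (E_col _ Qn); apply: E_diag.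
move: le_pr; rewrite leq_eqVlt => /predU1P[e|lt_pr].
  by rewrite (_ : p = Ordinal lt_rn') //; apply: val_inj.
exact: leq_trans step (IH lt_rn' lt_pr).
Qed.

Lemma filling_colP k Q p : (Q <= n)%N ->
  (p < card_below Q (filling_col k))%N = (k < E p Q)%N.
Proof.
move=> Qn; rewrite card_below_filling //.
rewrite (@initial_segment _ (fun p => k < E p Q)%N); last first.
  by move=> a b ab kE; apply: leq_trans kE _; apply: filling_row_le.
by rewrite /height -sum1_card [in RHS]big_mkcond; congr (_ < _)%N; apply: eq_bigr.
Qed.

End Filling.

End MatrixPolynomials.

From mathcomp Require Import complex.
From mathcomp Require Import all_classical all_reals all_analysis.

Import -(notations) mpoly.
Import MatrixPolynomials.
Import numFieldNormedType.Exports.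

Local Open Scope classical_set_scope.
Local Open Scope ring_scope.

(** * Polynomials as functions on the general linear group *)
Section Evaluation.
Variables (C : numFieldType) (n : nat).
Implicit Types (p r i j c : 'I_n) (Q : nat).
Local Notation poly := (mpoly (n * n) C).
Implicit Types (f h : poly).

(** The value at the variable k, written as a sum over all entries so that row and
column of k need not be computed. *)
Definition entries (A : 'M[C]_n) : 'I_(n * n) -> C :=
  fun k => \sum_p \sum_j A p j * (k == var p j)%:R.

Lemma entriesE A p j : entries A (var p j) = A p j.
Proof.
rewrite /entries (bigD1 p) //= (bigD1 j) //= eqxx mulr1 !big1 ?addr0 // => [r rp|c cj].
  by rewrite big1 // => c _; rewrite var_eqE eq_sym (negPf rp) mulr0.
by rewrite var_eqE [j == c]eq_sym (negPf cj) andbF mulr0.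
Qed.

Definition ev f : GL C n -> C^o := fun g => meval (entries (val g)) f.

Lemma ev_linear a f h : ev (a *: f + h) = a *: ev f + ev h.
Proof. by apply/funext => g; rewrite /ev mevalD mevalZ. Qed.

Lemma ev0 : ev 0 = 0.
Proof. by apply/funext => g; rewrite /ev meval0. Qed.

Definition deriv_along (a b : 'I_(n * n) -> C) f : C := \sum_k b k * meval a (mderiv k f).

Lemma is_derive_meval (a b : 'I_(n * n) -> C) f :
  is_derive (0 : C) 1 (fun t => meval (fun k => a k + t * b k) f : C^o) (deriv_along a b f).
Proof.
pose P f := is_derive (0 : C) 1 (fun t => meval (fun k => a k + t * b k) f : C^o)
  (deriv_along a b f).
have at0 h : meval (fun k => a k + 0 * b k) h = meval a h.
  by apply: meval_eq => k; rewrite mul0r addr0.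
have PC (z : C) : P (mpolyC _ z).
  rewrite /P /deriv_along big1; last by move=> k _; rewrite mderivC meval0 mulr0.
  rewrite (_ : (fun=> _) = cst z); first exact: is_derive_cst.
  by apply/funext => t; rewrite mevalC.
have PU k : P (mpolyX C (mnm1 k)).
  rewrite /P /deriv_along (bigD1 k) //= mderiv_var eqxx meval1 mulr1 big1 ?addr0; last first.
    by move=> l /negPf lk; rewrite mderiv_var eq_sym lk meval0 mulr0.
  rewrite (_ : (fun=> _) = cst (a k) + (b k) *: (id : C^o -> C^o)); last first.
    by apply/funext => t; rewrite mevalXU /= mulrC.
  have idd : is_derive (0 : C^o) (1 : C^o) (id : C^o -> C^o) (1 : C^o).
    exact: is_derive_id.
  have cstd := is_derive_cst (a k : C^o) (0 : C^o) (1 : C^o).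
  apply: (is_derive_eq (is_deriveD cstd (is_deriveZ (b k) idd))).
  by rewrite add0r /GRing.scale /= mulr1.
have PD h h' : P h -> P h' -> P (h + h').
  rewrite /P => Ph Ph'.
  rewrite (_ : (fun=> _) = (fun t => meval (fun k => a k + t * b k) h : C^o) +
     (fun t => meval (fun k => a k + t * b k) h' : C^o)); last first.
    by apply/funext => t; rewrite mevalD.
  apply: (is_derive_eq (is_deriveD Ph Ph')).
  rewrite /deriv_along -big_split; apply: eq_bigr => k _.
  by rewrite mderivD mevalD mulrDr.
have PM h h' : P h -> P h' -> P (h * h').
  rewrite /P => Ph Ph'.
  rewrite (_ : (fun=> _) = (fun t => meval (fun k => a k + t * b k) h : C^o) *
     (fun t => meval (fun k => a k + t * b k) h' : C^o)); last first.
    by apply/funext => t; rewrite mevalM.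
  apply: (is_derive_eq (is_deriveM Ph Ph')).
  rewrite !at0 /deriv_along /GRing.scale /= !mulr_sumr -big_split; apply: eq_bigr => k _ /=.
  by rewrite mderivM mevalD !mevalM; ring.
have PXn (h : poly) e : P h -> P (h ^+ e).
  move=> Ph; elim: e => [|e IH]; first by rewrite expr0 -mpolyC1.
  by rewrite exprS; apply: PM.
apply: (@mpolyind _ _ P) => [|c m h _ _ Ph]; first by rewrite -mpolyC0.
apply: PD => //; rewrite -mul_mpolyC; apply: (PM) => //.
rewrite mpolyXE_id; apply: (big_ind P); [by rewrite -mpolyC1 | exact: PM |].
by move=> k _; apply: PXn.
Qed.

(** For E = E_(i,j) one has E E = [i = j] E, so that the inverse of 1 + t E is
1 - s E with s = t / (1 + t [i = j]). *)
Lemma unit_near0 i j :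
  \forall t \near (0 : C), 1%:M + t *: delta_mx i j \in @unitmx C n.
Proof.
exists 1 => /= [//|t]; rewrite /= sub0r normrN => t1.
have t1' : 1 + t * (j == i)%:R != 0.
  case: (j == i) => /=; last by rewrite mulr0 addr0 oner_eq0.
  rewrite mulr1 addrC.
  apply: contraTneq t1 => /eqP; rewrite addr_eq0 => /eqP ->.
  by rewrite normrN normr1 ltxx.
have : (1%:M + t *: delta_mx i j) *m
    (1%:M - (t / (1 + t * (j == i)%:R)) *: delta_mx i j) = 1%:M.
  rewrite mulmxBr mulmx1 mulmxDl mul1mx -scalemxAl -scalemxAr mul_delta_mx_cond.
  rewrite -[delta_mx i j *+ _]scaler_nat !scalerA -scalerDl -addrA -scalerBl.
  set e := (X in X *: _); suff -> : e = 0 by rewrite scale0r addr0.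
  by rewrite /e; field.
by case/mulmx1_unit.
Qed.

Lemma Eact_ev i j f : Eact i j (ev f) = ev (colop i j f).
Proof.
apply/funext => g; rewrite /Eact /gl_act derive1E.
pose a := entries (val g); pose b := entries (val g *m delta_mx i j).
have <- : deriv_along a b f = ev (colop i j f) g.
  rewrite /ev /colop /deriv_along raddf_sum /=.
  rewrite big_var; apply: eq_bigr => p _.
  rewrite (bigD1 j) //= big1 ?addr0 => [|c cj]; last first.
    rewrite /b entriesE !mxE big1 ?mul0r // => k _.
    by rewrite !mxE (negPf cj) andbF mulr0.
  rewrite /polar mevalM mevalXU /b entriesE; congr (_ * _).
  rewrite !mxE (bigD1 i) //= !mxE !eqxx mulr1 big1 ?addr0 ?entriesE // => k ki.
  by rewrite !mxE (negPf ki) mulr0.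
apply: (@derive_val _ _ _ _ _ _ _ _); apply: near_eq_is_derive (is_derive_meval a b f).
have := unit_near0 i j; apply: filterS => t tu.
rewrite /rshift /ev; apply: meval_eq => k.
have [p [c ->]] := varP k; rewrite /a /b !entriesE.
rewrite /GLmul /= insubdK //= mulmxDr mulmx1 -scalemxAr !mxE.
by [].
Qed.

End Evaluation.

Section Dictionary.
Variables (C : numFieldType) (n : nat).
Implicit Types (p r i j c : 'I_n) (Q : nat).
Local Notation poly := (mpoly (n * n) C).
Implicit Types (f g h w : poly).

(** If f vanishes on the group then so do the E_(i,c) f.  They are the entries of
the product of the transposed group element, which is invertible, with the
matrix of partial derivatives. *)
Lemma ev_mderiv f : ev f = 0 -> forall k, ev (mderiv k f) = 0.
Proof.
move=> f0 k; apply/funext => A; have [p [j ->]] := varP k.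
pose d : 'M[C]_n := \matrix_(r, c) meval (entries (val A)) (mderiv (var r c) f).
have : (val A)^T *m d = 0.
  apply/matrixP => i c; rewrite !mxE.
  have := congr1 (@^~ A) (Eact_ev i c f); rewrite f0.
  have -> : Eact i c (0 : GL C n -> C^o) = 0.
    have := Eact_ev i c (0 : poly); rewrite raddf0 ev0 //.
  move=> /= e0; rewrite [RHS]e0 /ev /colop raddf_sum /=; apply: eq_bigr => r _.
  by rewrite /polar mevalM mevalXU entriesE !mxE.
move/(congr1 (mulmx (invmx (val A)^T))); rewrite mulKmx ?unitmx_tr ?(valP A) //.
by rewrite mulmx0 => /matrixP/(_ p j); rewrite !mxE.
Qed.

(** By [ev_mderiv] and induction on the degree all partial derivatives vanish, so
f is constant. *)
Lemma ev_inj0 f : ev f = 0 -> f = 0.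
Proof.
have [N leN] : exists N, forall m, m \in msupp f -> (mdeg m < N)%N.
  by exists (mmeasure mdeg f) => m; apply: msize_mdeg_lt.
elim: N f leN => [|N IH] f leN f0.
  by apply: msuppnil0; case: (msupp f) leN => // m s /(_ m (mem_head _ _)).
have df0 k : mderiv k f = 0.
  apply: IH (ev_mderiv f0 k) => m; rewrite mcoeff_msupp mcoeff_mderiv => fm.
  rewrite -ltnS; apply: leq_trans (leN (mnm_add m (mnm1 k)) _).
    by rewrite mdegD mdeg1 addn1.
  by rewrite mcoeff_msupp; apply: contraNneq fm => ->; rewrite mul0rn.
have fC : f = mpolyC _ (mcoeff mnm0 f).
  apply/mpolyP => m; rewrite mcoeffC; case: eqVneq => [->|m0]; first by rewrite mulr1.
  rewrite mulr0; have [k mk] : exists k, (0 < m k)%N.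
    apply/existsP; apply: contraNT m0 => /existsPn m0; apply/eqP/mnmP => k.
    by rewrite mnm0E; apply/eqP; rewrite -leqn0 leqNgt m0.
  have [m' ->] := mnm_subK mk; have := congr1 (mcoeff m') (df0 k).
  by rewrite mcoeff_mderiv mcoeff0 => /eqP; rewrite mulrn_eq0 => /eqP.
have := congr1 (@^~ (GLone C n)) f0; rewrite {1}fC /ev /= mevalC => c0.
by rewrite fC c0 mpolyC0.
Qed.

Lemma ev_inj : injective (@ev C n).
Proof.
move=> f h e; apply/eqP; rewrite -subr_eq0; apply/eqP/ev_inj0.
have := ev_linear (-1) h f; rewrite scaleN1r addrC => ->.
by rewrite e scaleN1r addNr.
Qed.

Lemma ev_minor (X : {set 'I_n}) (A : GL C n) : ev (minor C X) A = a_ X A.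
Proof.
rewrite /ev /minor -det_map_mx /a_; congr (\det _); apply/matrixP => k l.
rewrite !mxE /= mevalXU entriesE; congr (val A _ _); exact: val_inj.
Qed.

Variables (m : 'I_n -> int).
Hypothesis hm : forall p p' : 'I_n, (p <= p')%N -> m p' <= m p.
Hypothesis hm0 : forall p : 'I_n, p.+1 = n -> m p = 0.

Definition top_row p : nat := `|m p|%N.

Lemma weight_ge0 p : 0 <= m p.
Proof.
have n0 : (0 < n)%N by apply: leq_trans (ltn_ord p).
have lt_n : (n.-1 < n)%N by rewrite prednK.
rewrite -(hm0 (p := Ordinal lt_n)) ?prednK //=; apply: hm => /=.
by rewrite -ltnS prednK.
Qed.

Definition highest_poly : poly :=
  \prod_(p < n) \prod_(p' < n | p' == p.+1 :> nat)
    (inv_fact C (m p - m p') *: minor C [set k : 'I_n | (k <= p)%N]%SET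
       ^+ `|m p - m p'|%N).

Lemma ev_highest_poly : highest_vector m = ev highest_poly.
Proof.
apply/funext => A; rewrite /highest_vector /ev /highest_poly rmorph_prod /=.
apply: eq_bigr => p _; rewrite rmorph_prod /=; apply: eq_bigr => p' /eqP p'E.
rewrite mevalZ rmorphXn /= -/(ev _ A) ev_minor mulrC; congr (_ * _).
have : 0 <= m p - m p' by rewrite subr_ge0 hm // p'E.
by case: (m p - m p').
Qed.

(** The degrees in row r add up to the telescoping sum of the m_p - m_(p+1),
p >= r. *)
Lemma left_highest_hv : left_highest top_row highest_poly.
Proof.
(* m extended by 0, so that the last exponent m_n - 0 = 0 fits the pattern *)
pose mm (k : nat) : int := if insub k is Some p then m p else 0.
have mmE p : mm p = m p by rewrite /mm valK.
have mmn : mm n = 0 by rewrite /mm insubN // ltnn.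
apply: eq_left_highest; last first.
  apply: left_highest_prod => p _; apply: left_highest_prod => p' _.
  rewrite -[X in left_highest _ X]addr0.
  apply: left_highest_lin; last exact: left_highest0.
  apply: left_highestX; exact: left_highest_minor.
move=> r /=; apply/eqP; rewrite -eqz_nat /top_row gez0_abs ?weight_ge0 //; apply/eqP.
have card_le p : #|[set k : 'I_n | (k <= p)%N]%SET| = p.+1.
  rewrite cardsE -sum1_card (eq_bigl (fun k : 'I_n => (k < p.+1)%N)) //.
  by rewrite -(big_ord_widen _ (fun=> 1%N)) ?ltn_ord // sum1_card card_ord.
transitivity (\sum_(p < n | (r <= p)%N) (mm p - mm p.+1)).
  rewrite (big_morph Posz PoszD (erefl _)) [RHS]big_mkcond; apply: eq_bigr => p _.
  have [lt_pn | le_np] := ltnP p.+1 n.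
    rewrite (big_pred1 (Ordinal lt_pn)) => [|p']; last by rewrite /= -val_eqE.
    rewrite card_le ltnS; case: (r <= p)%N; last by rewrite muln0.
    rewrite muln1 gez0_abs ?subr_ge0 ?hm //= mmE.
    by rewrite -[p.+1]/(val (Ordinal lt_pn)) mmE.
  rewrite big_pred0 => [|p']; last by rewrite ltn_eqF // (leq_trans (ltn_ord p')).
  have pn : p.+1 = n by apply/eqP; rewrite eqn_leq le_np ltn_ord.
  by rewrite mmE hm0 // pn mmn subr0 if_same.
rewrite -(big_mkord (fun k : nat => (r <= k)%N) (fun k : nat => mm k - mm k.+1)).
rewrite -(@big_nat_widenl _ _ _ r 0 n predT (fun k : nat => mm k - mm k.+1)) //.
under eq_bigr do rewrite -opprB.
by rewrite sumrN telescope_sumr ?(ltnW (ltn_ord r)) // opprB mmE mmn subr0.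
Qed.

End Dictionary.

(** * Gelfand-Tsetlin vectors as polynomials *)
Section GTVectors.
Variables (C : numFieldType) (n : nat).
Implicit Types (p r i j c q : 'I_n) (Q : nat).
Local Notation poly := (mpoly (n * n) C).
Implicit Types (f g h w : poly).
Variables (m : 'I_n -> int).
Hypothesis hm : forall p p' : 'I_n, (p <= p')%N -> m p' <= m p.
Hypothesis hm0 : forall p : 'I_n, p.+1 = n -> m p = 0.

Lemma repV_poly (u : GL C n -> C^o) : repV m u ->
  exists2 f, left_highest (top_row m) f & u = ev f.
Proof.
pose W := [set u : GL C n -> C^o | exists2 f, left_highest (top_row m) f & u = ev f].
move=> /(_ W); apply.
  split.
  - by exists 0; [apply: left_highest0 | rewrite ev0].
  - move=> c _ _ [f fh ->] [h hh ->]; exists (c *: f + h); last by rewrite ev_linear.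
    exact: left_highest_lin.
  - move=> i j _ _ _ [f fh ->]; exists (colop i j f); last by rewrite Eact_ev.
    exact: left_highest_colop.
by exists (highest_poly C m); [apply: left_highest_hv | apply: ev_highest_poly].
Qed.

Lemma GT_diagram_ge0 (D : 'M[int]_n) p q : GT_diagram m D -> 0 <= D p q.
Proof.
move=> [D0 Dm Di]; have [k] := ubnP (n - q)%N; elim: k p q => // k IH p q.
rewrite ltnS => le_k; case: (ltnP q p) => [/D0 -> // | le_pq].
have [lt_qn | le_nq] := ltnP q.+1 n; last first.
  by rewrite Dm ?(weight_ge0 hm hm0) //; apply/eqP; rewrite eqn_leq le_nq ltn_ord.
have lt_pn : (p.+1 < n)%N by apply: leq_ltn_trans lt_qn.
have /andP[le_D _] := Di p q (Ordinal lt_pn) (Ordinal lt_qn) le_pq erefl erefl.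
by apply: le_trans le_D; apply: IH => /=; lia.
Qed.

(** The vectors of W killed by T form a submodule. *)
Lemma same_annihilators_irr Q (W : set (GL C n -> C^o)) g w : gl_irreducible Q W ->
  g != 0 -> w != 0 -> W (ev g) -> W (ev w) -> same_annihilators Q g w.
Proof.
move=> [[W0 Wlin WE] _ Wirr] g0 w0 Wg Ww T Tcol.
suff H h h' : h != 0 -> W (ev h) -> W (ev h') -> T h = 0 -> T h' = 0.
  by split; apply: H.
move=> h0 Wh Wh' Th.
pose U := [set u : GL C n -> C^o | W u /\ exists2 f, u = ev f & T f = 0].
have subU : gl_submodule Q U.
  split.
  - by split=> //; exists 0; rewrite ?ev0 ?raddf0.
  - move=> c u v [Wu [f uE Tf]] [Wv [f' vE Tf']]; split; first exact: Wlin.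
    rewrite uE vE.
    exists (c *: f + f'); first by rewrite ev_linear.
    by rewrite linearP /= Tf Tf' scaler0 addr0.
  - move=> i j iQ jQ u [Wu [f uE Tf]]; split; first exact: WE.
    by rewrite uE; exists (colop i j f); rewrite ?Eact_ev // Tcol // Tf raddf0.
have Uh : U (ev h) by split=> //; exists h.
have [U0 | UW] := Wirr U subU (fun u => @proj1 _ _).
  move: Uh; rewrite U0 => /= eh0; case/eqP: h0; apply: ev_inj.
  by rewrite eh0 ev0.
by move: Wh'; rewrite -UW => -[_ [f /ev_inj -> ]].
Qed.

(** All that is used of a Gelfand-Tsetlin vector. *)
Lemma GT_vector_poly (D : 'M[int]_n) (u : GL C n -> C^o) :
    GT_diagram m D -> GT_vector m D u ->
  exists g, [/\ u = ev g, left_highest (top_row m) g, g != 0 &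
    forall q : 'I_n, exists w, [/\ same_annihilators q.+1 g w, col_highest q.+1 w &
      col_homog q.+1 (fun p => `|D p q|%N) w]].
Proof.
move=> GTD [u0 /repV_poly[g gh ug] hq].
have g0 : g != 0 by apply/eqP => g0; apply: u0; rewrite ug g0 ev0.
exists g; split=> // q; have [W [WV Wirr [w' Ww' hw] Wu]] := hq q.
have [w _ wE] := repV_poly (WV _ Ww').
case: hw => w'0 hraise hdiag.
have w0 : w != 0 by apply/eqP => w0; apply: w'0; rewrite wE w0 ev0.
exists w; split.
- by apply: same_annihilators_irr Wirr g0 w0 _ _; rewrite -?ug -?wE.
- move=> i j ij jq; apply: ev_inj; rewrite ev0 -Eact_ev -wE.
  exact: hraise.
- apply: col_eigen_homog => j jq; apply: ev_inj; rewrite -Eact_ev -wE hdiag //.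
  have := ev_linear (`|D j q|%N%:R) w 0; rewrite ev0 !addr0 scaler_nat => ->.
  by rewrite wE -[in LHS](gez0_abs (GT_diagram_ge0 j q GTD)).
Qed.

Lemma GT_poly_content (D : 'M[int]_n) g : GT_diagram m D ->
    left_highest (top_row m) g -> g != 0 ->
    (forall q : 'I_n, exists w, [/\ same_annihilators q.+1 g w, col_highest q.+1 w &
      col_homog q.+1 (fun p => `|D p q|%N) w]) ->
  (forall q p, row_content q.+1 p (mlead g) = `|D p q|%N) /\
  (forall k, k \in msupp g -> dominated (mlead g) k).
Proof.
move=> [D0 _ _] [grow gmu] g0 hq.
have lead q p : row_content q.+1 p (mlead g) = if (p < q.+1)%N then `|D p q|%N else 0%N.
  by have [w [h1 h2 h3]] := hq q; exact: (content_mlead g0 gmu grow h1 h2 h3 p).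
split=> [q p | k gk Q].
  by rewrite lead ltnS; case: leqP => // /D0 ->.
(* there are only n columns *)
have rcn R p M : (n <= R)%N -> row_content R p M = row_content n p M.
  move=> nR; apply: eq_bigl => c; rewrite (ltn_ord c).
  exact: leq_trans (ltn_ord c) nR.
case: Q => [|Q].
  have tc0 t M : top_content 0 t M = 0%N.
    by rewrite /top_content big1 // => p _; rewrite /row_content big_pred0.
  by split=> [t|]; rewrite !tc0.
case: (ltnP Q n) => Qn; last first.
  have tcE t M : top_content Q.+1 t M = \sum_(p < n | (p < t)%N) row_content n p M.
    by apply: eq_bigr => p _; rewrite rcn // ltnW.
  have e : forall t, top_content Q.+1 t k = top_content Q.+1 t (mlead g).
    move=> t; rewrite !tcE; apply: eq_bigr => p _.
    by rewrite (gmu _ gk) (gmu _ (mlead_supp g0)).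
  by split=> [t|]; rewrite e.
have [w [h1 h2 h3]] := hq (Ordinal Qn).
have [le_t eq_n] := content_dominated h1 h2 h3 gk; split=> [t|].
  apply: leq_trans (le_t t) _; rewrite big_mkcondr /=.
  by apply: leq_sum => p _; rewrite (lead (Ordinal Qn) p).
rewrite /top_content [LHS](eq_bigl predT) => [|p]; last by rewrite ltn_ord.
rewrite [LHS]eq_n big_mkcond /= [RHS](eq_bigl predT) => [|p]; last by rewrite ltn_ord.
by apply: eq_bigr => p _; rewrite (lead (Ordinal Qn) p).
Qed.

End GTVectors.

Section LeadingDiagram.
Variables (C : numClosedFieldType) (n : nat).
Implicit Types (p r i j c q : 'I_n) (Q : nat).
Variables (m : 'I_n -> int).
Hypothesis hm : forall p p' : 'I_n, (p <= p')%N -> m p' <= m p.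
Hypothesis hm0 : forall p : 'I_n, p.+1 = n -> m p = 0.

(** The betweenness conditions are [mlead_interlace]; the entries below the
diagonal vanish because interlacing carries them back to an empty set of
columns. *)
Lemma GT_diagram_mlead (f : mpoly (n * n) C) : f != 0 -> left_highest (top_row m) f ->
  GT_diagram m (\matrix_(p, q) (row_content q.+1 p (mlead f))%:Z).
Proof.
move=> f0 [frow fmu]; set M := mlead f.
have step p r q : r = p.+1 :> nat -> (row_content q.+1 r M <= row_content q p M)%N.
  exact: mlead_interlace f0 fmu frow.
have low p Q : (Q <= p)%N -> (Q <= n)%N -> row_content Q p M = 0%N.
  have [k] := ubnP (p : nat); elim: k p Q => // k IH p Q; rewrite ltnS => pk Qp Qn.
  case: Q Qp Qn => [|Q] Qp Qn; first by rewrite /row_content big_pred0.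
  have lt_p : (p.-1 < n)%N by apply: leq_ltn_trans (leq_pred _) (ltn_ord p).
  have p0 : (0 < p)%N by apply: leq_ltn_trans Qp.
  apply/eqP; rewrite -leqn0 -[X in (_ <= X)%N](IH (Ordinal lt_p) Q) /= ; try lia.
  by apply: (step (Ordinal lt_p) p (Ordinal Qn)); rewrite /= prednK.
split=> [p q qp | p q qn | p q p' q' pq p'E q'E]; rewrite !mxE.
- by rewrite low.
- rewrite qn (fmu _ (mlead_supp f0)) /top_row gez0_abs //.
  exact: weight_ge0.
- rewrite !lez_nat -q'E; apply/andP; split; first exact: step.
  rewrite q'E /row_content [leqRHS]big_mkcond [leqLHS]big_mkcond /=.
  apply: leq_sum => c _; case: (ltnP c q.+1) => // cq.
  by rewrite (leq_trans cq).
Qed.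

End LeadingDiagram.

(** * The Gamma-series as a polynomial *)
Section LevelSums.
Variable n : nat.
Implicit Types (p q : 'I_n) (u v : {ffun psub n -> int}).

Lemma level_sumE p q v :
  level_sum p q v = \sum_(X : psub n | (p < card_below q.+1 (val X))%N) v X.
Proof.
apply: eq_bigl => X; congr (_ < _)%N; apply: eq_card => j.
by rewrite !inE ltnS.
Qed.

Lemma level_sum_is_additive p q : zmod_morphism (@level_sum n p q).
Proof.
move=> u v; rewrite /level_sum -sumrB; apply: eq_bigr => X _.
by rewrite !ffunE.
Qed.

HB.instance Definition _ p q :=
  GRing.isZmodMorphism.Build {ffun psub n -> int} int (@level_sum n p q)
    (level_sum_is_additive p q).

Lemma coset_shift_vector (D : 'M[int]_n) gam v : shift_vector D gam ->
  coset gam v <-> shift_vector D v.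
Proof.
move=> hgam; split=> h p q pq.
  by have /eqP := h p q pq; rewrite raddfB /= subr_eq0 hgam // => /eqP.
by rewrite raddfB /= h // hgam // subrr.
Qed.

End LevelSums.

Section GammaPolynomial.
Variables (C : numFieldType) (n : nat).
Implicit Types (p r i j c q : 'I_n) (Q : nat).
Local Notation poly := (mpoly (n * n) C).
Variables (m : 'I_n -> int) (D : 'M[int]_n).
Hypothesis hm : forall p p' : 'I_n, (p <= p')%N -> m p' <= m p.
Hypothesis hm0 : forall p : 'I_n, p.+1 = n -> m p = 0.
Hypothesis GTD : GT_diagram m D.

Let D_ge0 p q : 0 <= D p q := GT_diagram_ge0 hm hm0 p q GTD.

(** A nonnegative element of the coset has coordinates at most m_1, the number of
all columns.  The maximum of all entries is a bound that needs no case
distinction on n. *)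
Definition exponent_bound : nat := \max_(pq : 'I_n * 'I_n) `|D pq.1 pq.2|%N.

Local Notation exponents := {ffun psub n -> 'I_exponent_bound.+1}.

Definition intvec (x : exponents) : {ffun psub n -> int} := [ffun X => Posz (x X)].

Definition D_filling : pred exponents := fun x => `[< shift_vector D (intvec x) >].

Definition gamma_poly : poly :=
  \sum_(x | D_filling x) (\prod_X inv_fact C (x X)) *: \prod_X minor C (val X) ^+ x X.

Lemma leq_exponent_bound p q : (`|D p q| <= exponent_bound)%N.
Proof. exact: (@leq_bigmax _ (fun pq : 'I_n * 'I_n => `|D pq.1 pq.2|%N) (p, q)). Qed.

Lemma inv_fact_lt0 (a : int) : a < 0 -> inv_fact C a = 0.
Proof. by case: a. Qed.

Lemma psub_card_below (X : psub n) : (0 < card_below n (val X) < n)%N.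
Proof. by rewrite card_belowT; apply: (valP X). Qed.

Lemma shift_vector_bound v (X : psub n) : shift_vector D v -> (forall Y, 0 <= v Y) ->
  v X <= exponent_bound%:Z.
Proof.
move=> hv v0; have := psub_card_below X => /andP[_ cX].
have n0 : (0 < n)%N by apply: leq_ltn_trans cX.
have lt_n : (n.-1 < n)%N by rewrite prednK.
have := hv (Ordinal n0) (Ordinal lt_n) isT; rewrite level_sumE /= prednK // => hD.
apply: le_trans (_ : _ <= D (Ordinal n0) (Ordinal lt_n)) _.
  rewrite -hD (bigD1 X) /=; last by have /andP[] := psub_card_below X.
  by rewrite lerDl sumr_ge0.
by rewrite -[X in X <= _]gez0_abs // lez_nat leq_exponent_bound.
Qed.

(** The terms of the series with a negative exponent vanish; the exponents of the
others are bounded. *)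
Lemma Fvec_gamma_poly gam : shift_vector D gam -> Fvec gam = ev gamma_poly.
Proof.
move=> hgam; apply/funext => A; rewrite /Fvec /Fseries.
pose s := [seq intvec x | x <- enum D_filling].
have inj : injective intvec.
  move=> x y /ffunP e; apply/ffunP => X; apply: val_inj.
  by have := e X; rewrite !ffunE => -[].
rewrite (fsbigE s) //=; first last.
- move=> v vcos; apply: contraNeq => nz.
  have v_shift : shift_vector D v by apply/(coset_shift_vector v hgam).
  have v0 X : 0 <= v X.
    rewrite leNgt; apply: contra nz => vX; rewrite (bigD1 X) //=.
    by rewrite inv_fact_lt0 // mulr0 mul0r.
  have vb X : (`|v X| < exponent_bound.+1)%N.
    by rewrite ltnS -lez_nat gez0_abs // shift_vector_bound.
  apply/mapP; exists [ffun X => Ordinal (vb X)]; last first.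
    by apply/ffunP => X; rewrite !ffunE /= gez0_abs.
  rewrite mem_enum; apply/asboolP; congr (shift_vector D _): v_shift.
  by apply/ffunP => X; rewrite !ffunE /= gez0_abs.
- move=> v /= /mapP[x]; rewrite mem_enum => /asboolP hx ->.
  exact/(coset_shift_vector _ hgam).
- by rewrite map_inj_uniq // enum_uniq.
rewrite big_seq_cond (eq_bigl (fun v => v \in s)); last first.
  move=> v; case: (boolP (v \in s)) => //= /mapP[x]; rewrite mem_enum => /asboolP hx ->.
  by apply/mem_set/(coset_shift_vector _ hgam).
rewrite -big_seq /s big_map big_enum /=.
rewrite /ev /gamma_poly raddf_sum /=; apply: eq_bigr => x _.
rewrite mevalZ rmorph_prod /= -big_split; apply: eq_bigr => X _ /=.
by rewrite ffunE mulrC rmorphXn /= -/(ev _ A) ev_minor.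
Qed.

Definition filling_mnm (x : exponents) :=
  (\big[@mnm_add (n * n)/mnm0]_(X : psub n) mnm_muln (minor_lead (val X)) (x X)).

(** The diagonal monomial of the minor of X has an entry in row p and the columns
up to q exactly if X has more than p elements up to q: the level sums count
these X. *)
Lemma filling_mnm_content x p q : D_filling x ->
  row_content q.+1 p (filling_mnm x) = `|D p q|%N.
Proof.
move=> /asboolP hx; rewrite /filling_mnm row_content_sum.
have -> : (\sum_X row_content q.+1 p (mnm_muln (minor_lead (val X)) (x X)) =
   \sum_(X : psub n | (p < card_below q.+1 (val X))%N) x X)%N.
  rewrite [RHS]big_mkcond; apply: eq_bigr => X _ /=.
  have -> : row_content q.+1 p (mnm_muln (minor_lead (val X)) (x X)) =
      (row_content q.+1 p (minor_lead (val X)) * x X)%N.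
    by rewrite /row_content big_distrl; apply: eq_bigr => c _; rewrite mulmnE.
  by rewrite minor_lead_content; case: (_ < _)%N; rewrite ?mul1n ?mul0n.
case: (leqP p q) => [pq|qp].
  apply/eqP; rewrite -eqz_nat gez0_abs // -(hx _ _ pq) level_sumE.
  rewrite (big_morph Posz PoszD (erefl _)); apply/eqP; apply: eq_bigr => X _.
  by rewrite ffunE.
case: GTD => /(_ _ _ qp) -> _ _; rewrite big_pred0 // => X.
apply/negbTE; rewrite -leqNgt (leq_trans _ qp) //.
rewrite /card_below -sum1dep_card.
apply: leq_trans (_ : _ <= \sum_(j < n | (j < q.+1)%N) 1)%N _.
  by rewrite [leqLHS]big_mkcondl /=; apply: leq_sum => j _; case: ifP.
by rewrite -(big_ord_widen _ (fun=> 1%N)) ?ltn_ord // sum1_card card_ord.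
Qed.

Lemma left_highest_gamma_poly : left_highest (top_row m) gamma_poly.
Proof.
rewrite /gamma_poly; apply: big_ind; first exact: left_highest0.
  move=> f g hf hg; rewrite -[f]scale1r; exact: left_highest_lin.
move=> x hx; rewrite -[X in left_highest _ X]addr0.
apply: left_highest_lin; last exact: left_highest0.
apply: eq_left_highest; last first.
  apply: left_highest_prod => X _; apply: left_highestX; exact: left_highest_minor.
move=> p /=; have n0 : (0 < n)%N by apply: leq_ltn_trans (ltn_ord p).
have lt_n : (n.-1 < n)%N by rewrite prednK.
case: GTD => _ Dm _; rewrite /top_row -(Dm p (Ordinal lt_n)) ?prednK //.
rewrite -(filling_mnm_content _ _ hx) /filling_mnm row_content_sum /= prednK //.
apply: eq_bigr => X _.
have -> : row_content n p (mnm_muln (minor_lead (val X)) (x X)) =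
      (x X * row_content n p (minor_lead (val X)))%N.
  by rewrite /row_content big_distrr; apply: eq_bigr => c _; rewrite mulmnE mulnC.
by rewrite minor_lead_content card_belowT.
Qed.

(** The tableau of the diagram: the exponent of a column is the number of times
that it occurs as [filling_col]. *)
Lemma exists_filling : exists x, D_filling x.
Proof.
case: GTD => Dlow _ Dint.
pose E p Q : nat :=
  if Q is Q'.+1 then (if insub Q' is Some q then `|D p q|%N else 0%N) else 0%N.
have ES p q : E p q.+1 = `|D p q|%N by rewrite /E valK.
have E0 p : E p 0 = 0%N by [].
have Elow p q : (q < p)%N -> E p q.+1 = 0%N by rewrite ES => /Dlow ->.
have E_col p Q : (Q < n)%N -> (E p Q <= E p Q.+1)%N.
  case: Q => // Q lt_Qn; have lt_Qn' := ltnW lt_Qn.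
  have [pQ | Qp] := leqP p Q; last by rewrite (Elow p (Ordinal lt_Qn')).
  have lt_pn : (p.+1 < n)%N by apply: leq_ltn_trans lt_Qn.
  have /andP[_] :=
    Dint p (Ordinal lt_Qn') (Ordinal lt_pn) (Ordinal lt_Qn) pQ erefl erefl.
  rewrite (ES p (Ordinal lt_Qn')) (ES p (Ordinal lt_Qn)).
  by rewrite -lez_nat !gez0_abs.
have E_diag p r Q : (Q < n)%N -> r = p.+1 :> nat -> (E r Q.+1 <= E p Q)%N.
  move=> lt_Qn rE; case: Q lt_Qn => [|Q] lt_Qn.
    by rewrite (Elow r (Ordinal lt_Qn)) //= rE.
  have lt_Qn' := ltnW lt_Qn.
  have [pQ | Qp] := leqP p Q; last by rewrite (Elow r (Ordinal lt_Qn)) //= rE.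
  have /andP[+ _] := Dint p (Ordinal lt_Qn') r (Ordinal lt_Qn) pQ rE erefl.
  rewrite (ES p (Ordinal lt_Qn')) (ES r (Ordinal lt_Qn)).
  by rewrite -lez_nat !gez0_abs.
have [n0 | n0] := posnP n.
  exists [ffun=> ord0]; apply/asboolP => p.
  by have := leq_ltn_trans (leq0n p) (ltn_ord p); rewrite lt0n => /eqP.
have lt_n : (n.-1 < n)%N by rewrite prednK.
pose K := E (Ordinal n0) n.
have En p : E p n = `|D p (Ordinal lt_n)|%N.
  by rewrite -ES; congr (E p _); rewrite /= prednK.
have leK p Q : (Q <= n)%N -> (E p Q <= K)%N.
  move=> Qn; apply: leq_trans (_ : _ <= E p n)%N _.
    have H d : (Q + d <= n)%N -> (E p Q <= E p (Q + d))%N.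
      elim: d => [|d IH] Qd; first by rewrite addn0.
      rewrite addnS in Qd *; apply: leq_trans (IH (ltnW Qd)) _; exact: E_col.
    by have := H (n - Q)%N; rewrite subnKC //; apply.
  have [p0 | p0] := posnP p; first by rewrite (_ : p = Ordinal n0) //; apply: val_inj.
  exact: (filling_row_le E0 E_col E_diag).
pose col k := filling_col E k.
have colP k Q p : (Q <= n)%N -> (p < card_below Q (col k))%N = (k < E p Q)%N.
  exact: (filling_colP E0 E_col E_diag).
have col_psub (k : 'I_K) : (0 < #|col k| < n)%N.
  rewrite -card_belowT (colP k n (Ordinal n0)) // ltn_ord /=.
  rewrite ltnNge; apply/negP => le_nc.
  have := colP k n (Ordinal lt_n) (leqnn n); rewrite /= (leq_trans _ le_nc) ?prednK //.
  by rewrite En; case: GTD => _ -> //=; rewrite ?prednK // hm0 //= prednK.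
pose colS (k : 'I_K) : psub n := exist _ (col k) (col_psub k).
have cnt_lt X : (#|[set k | colS k == X]%SET| < exponent_bound.+1)%N.
  rewrite ltnS; apply: leq_trans (max_card _) _; rewrite card_ord /K En.
  exact: leq_exponent_bound.
exists [ffun X => Ordinal (cnt_lt X)]; apply/asboolP => p q pq.
rewrite level_sumE; transitivity (#|[set k : 'I_K | (k < E p q.+1)%N]%SET|%:Z).
  rewrite -sum1dep_card [in RHS]big_mkcond /=.
  rewrite (eq_bigr (fun X : psub n => (\sum_(k < K) (colS k == X))%:Z)); last first.
    move=> X _; rewrite !ffunE /= -sum1dep_card big_mkcond /=; congr Posz.
  rewrite -(big_morph Posz PoszD (erefl _)) exchange_big /=; congr Posz.
  apply: eq_bigr => k _; rewrite -(colP k q.+1 p (ltn_ord q)).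
  have [kc | kc] := boolP (p < card_below q.+1 (col k))%N.
    rewrite (bigD1 (colS k)) //= eqxx big1 // => X /andP[_ /negPf].
    by rewrite eq_sym => ->.
  by rewrite big1 // => X hX; case: eqP => // e; rewrite -e /= (negPf kc) in hX.
have leEK : (E p q.+1 <= K)%N := leK p _ (ltn_ord q).
rewrite -sum1dep_card -(big_ord_widen _ (fun=> 1%N)) // sum1_card card_ord ES.
by rewrite gez0_abs.
Qed.

Lemma gamma_poly_lead K : (forall q p, row_content q.+1 p K = `|D p q|%N) ->
  (forall k, k \in msupp gamma_poly -> dominated K k) /\ mcoeff K gamma_poly != 0.
Proof.
move=> hK; have lead x : D_filling x -> leading K (\prod_X minor C (val X) ^+ x X).
  move=> hx; have -> : K = filling_mnm x.
    by apply: row_content_inj => q p; rewrite hK filling_mnm_content.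
  by apply: leading_prod => X; apply/leadingX/leading_minor.
have inv_ge0 (k : nat) : 0 < inv_fact C k by rewrite /= invr_gt0 ltr0n fact_gt0.
split.
  move=> k /msupp_sum_le/flatten_mapP[x]; rewrite mem_filter => /andP[hx _].
  by move/msuppZ_le; have [h _] := lead x hx; apply: h.
rewrite /gamma_poly raddf_sum /=.
under eq_bigr => x hx do rewrite mcoeffZ (proj2 (lead x hx)) mulr1.
have [x hx] := exists_filling.
rewrite (bigD1 x) //=; apply: lt0r_neq0; apply: ltr_pwDl.
  by apply: prodr_gt0 => X _; apply: inv_ge0.
by apply: sumr_ge0 => y _; apply: prodr_ge0 => X _; apply/ltW/inv_ge0.
Qed.

End GammaPolynomial.

(** * The order on cosets *)
Section Cone.
Variable n : nat.
Implicit Types (p q i j x : 'I_n) (v : {ffun psub n -> int}).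

Definition cone v := exists s : quad n -> nat, v = \sum_(al : quad n) rvec al *+ s al.

Lemma cone0 : cone 0.
Proof. by exists (fun=> 0%N); rewrite big1. Qed.

Lemma coneD u v : cone u -> cone v -> cone (u + v).
Proof.
move=> [s ->] [t ->]; exists (fun al => s al + t al)%N.
by rewrite -big_split; apply: eq_bigr => al _; rewrite mulrnDr.
Qed.

Lemma cone_muln v e : cone v -> cone (v *+ e).
Proof.
move=> [s ->]; exists (fun al => s al * e)%N.
by rewrite -sumrMnl; apply: eq_bigr => al _; rewrite mulrnA.
Qed.

Lemma cone_rvec al : cone (rvec al).
Proof.
exists (fun be => be == al); rewrite (bigD1 al) //= eqxx big1 ?addr0 // => be /negPf ->.
by rewrite mulr0n.
Qed.

Lemma level_sum_unit_vec p q (Y : {set 'I_n}) : (0 < #|Y| < n)%N ->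
  level_sum p q (unit_vec Y) = (p < card_below q.+1 Y)%N%:R.
Proof.
move=> hY; rewrite level_sumE; pose X0 : psub n := exist _ Y hY.
have unitE X : unit_vec Y X = (X == X0)%:R by rewrite ffunE -val_eqE.
case: (boolP (p < card_below q.+1 Y)%N) => hp; last first.
  rewrite big1 // => X hX; rewrite unitE; case: eqP => // e.
  by rewrite e /= (negPf hp) in hX.
rewrite (bigD1 X0) //= unitE eqxx big1 ?addr0 // => X /andP[_ /negPf].
by rewrite unitE => ->.
Qed.

Lemma card_belowU1 Q i (X : {set 'I_n}) : i \notin X ->
  card_below Q (X :|: [set i])%SET = (card_below Q X + (i < Q))%N.
Proof.
move=> iX; rewrite /card_below; case: ltnP => iQ; last first.
  rewrite addn0; apply: eq_card => j; rewrite !inE.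
  case: (eqVneq j i) => [->|_]; last by rewrite orbF.
  by rewrite (ltnNge i) iQ !andbF.
rewrite addn1 -[RHS](_ : #|i |: [set j in X | (j < Q)%N]%SET| = _)%N.
  apply: eq_card => j; rewrite !inE.
  by case: (eqVneq j i) => [->|_]; rewrite ?iQ ?orbT ?orbF.
by rewrite cardsU1 inE (negPf iX) add1n.
Qed.

(** The vector r^alpha for x = j + 1 and X empty.  For the last index j the cyclic
successor is 0, which gives no quadruple, and the value is 0. *)
Definition elementary i j : {ffun psub n -> int} :=
  if (insub (i, j, ordS j, finset.set0) : option (quad n)) is Some al
  then rvec al else 0.

Lemma cone_elementary i j : cone (elementary i j).
Proof.
rewrite /elementary; case: insubP => [al _ _|_]; first exact: cone_rvec.
exact: cone0.
Qed.

(** The four sets differ in their number of elements up to q only by the presence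
of i, j and x = j + 1; unless q = j, the last two are present together or both
absent, and the contributions cancel. *)
Lemma level_sum_elementary p q i j : (p <= q)%N ->
  level_sum p q (elementary i j) =
  if [&& (i < j)%N, (j.+1 < n)%N & q == j]
  then (p == i.+1 :> nat)%:R - (p == i)%:R else 0.
Proof.
move=> pq; rewrite /elementary; case: insubP => [al|]; last first.
  rewrite /is_quad /= raddf0 => hn; case: ifP => // /and3P[ij jn _]; case/negP: hn.
  rewrite ij modn_small // ltnSn /=; apply/forallP => y; by rewrite inE.
rewrite {1}/is_quad => /and3P[ij jx _] alE.
have jn : (j.+1 < n)%N.
  rewrite ltnNge; apply/negP => nj.
  have jn : j.+1 = n by apply/eqP; rewrite eqn_leq nj ltn_ord.
  by move: jx; rewrite /= jn modnn leqNgt (leq_ltn_trans (leq0n j) (ltn_ord j)).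
have xE : ordS j = j.+1 :> nat by rewrite /= modn_small.
set x := ordS j in jx xE *; rewrite ij jn /=.
rewrite /rvec /vzero /vplus alE !finset.setU0 -/x.
set I := [set k : 'I_n | (k < i)%N]%SET.
have iI : i \notin I by rewrite inE ltnn.
have jI : j \notin I by rewrite inE -leqNgt ltnW.
have xI : x \notin I by rewrite inE -leqNgt xE ltnW // ltnW.
have jiI : j \notin (I :|: [set i])%SET.
  by rewrite !inE negb_or -leqNgt (ltnW ij) -val_eqE neq_ltn ij orbT.
have xjI : x \notin (I :|: [set j])%SET.
  by rewrite finset.in_setU (negPf xI) inE -val_eqE neq_ltn jx orbT.
rewrite !finset.setUA.
have cI : card_below q.+1 I = minn i q.+1.
  have -> : card_below q.+1 I = #|[set k : 'I_n | (k < minn i q.+1)%N]%SET|.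
    by apply: eq_card => k; rewrite !inE leq_min.
  rewrite -sum1dep_card -(big_ord_widen _ (fun=> 1%N)) ?sum1_card ?card_ord //.
  exact: leq_trans (geq_minr _ _) (ltn_ord q).
have prop (Y : {set 'I_n}) y z : y \in Y -> z \notin Y -> (0 < #|Y| < n)%N.
  move=> yY zY; apply/andP; split; first by apply/card_gt0P; exists y.
  rewrite ltnNge; apply: contra zY => nY.
  suff -> : Y = finset.setT by rewrite finset.in_setT.
  by apply/eqP; rewrite eqEcard finset.subsetT cardsT card_ord.
have neq_ij : i != j by rewrite -val_eqE neq_ltn ij.
have neq_jx : j != x by rewrite -val_eqE neq_ltn jx.
have neq_ix : i != x by rewrite -val_eqE neq_ltn (ltn_trans ij jx).
have iI_ : (i < i)%N = false by rewrite ltnn.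
have xI_ : (x < i)%N = false by rewrite ltnNge xE ltnW // ltnW.
have propx : (0 < #|(I :|: [set x])%SET| < n)%N.
  by apply: (prop _ x i); rewrite !inE ?eqxx ?orbT // iI_ (negPf neq_ix).
have propij : (0 < #|(I :|: [set i] :|: [set j])%SET| < n)%N.
  apply: (prop _ i x); rewrite !inE ?eqxx ?orbT // xI_.
  by rewrite ![x == _]eq_sym (negPf neq_ix) (negPf neq_jx).
have propi : (0 < #|(I :|: [set i])%SET| < n)%N.
  by apply: (prop _ i x); rewrite !inE ?eqxx ?orbT // xI_ [x == _]eq_sym (negPf neq_ix).
have propjx : (0 < #|(I :|: [set j] :|: [set x])%SET| < n)%N.
  by apply: (prop _ x i); rewrite !inE ?eqxx ?orbT // iI_ (negPf neq_ij) (negPf neq_ix).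
rewrite raddfB !raddfD /= !(level_sum_unit_vec _ _ propx).
rewrite !(level_sum_unit_vec _ _ propij).
rewrite !(level_sum_unit_vec _ _ propi) !(level_sum_unit_vec _ _ propjx).
rewrite !card_belowU1 // cI -!addnA; move: ij pq; rewrite xE -!val_eqE /=.
move: (i : nat) (j : nat) (p : nat) (q : nat) => a b c d ab cd.
have [lt_db | lt_bd | eq_db] := ltngtP d b; rewrite ?ltnS.
- rewrite [(b <= d)%N]leqNgt lt_db [(b < d)%N]ltnNge (ltnW lt_db) /= !addn0; ring.
- have ad : (a <= d)%N := ltnW (ltn_trans ab lt_bd).
  rewrite (ltnW lt_bd) lt_bd ad (minn_idPl (leqW ad)) /=; ring.
- rewrite -eq_db leqnn ltnn in ab *; have ad := ltnW ab.
  rewrite ad (minn_idPl (leqW ad)) /= !addn0 !addn1 addn2 !ltnS.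
  have [lt_ca | lt_ac | ->] := ltngtP c a.
  + by rewrite (leqW (ltnW lt_ca)) ltn_eqF ?(leqW lt_ca).
  + by case: (ltngtP c a.+1) => //; rewrite ltnS leqNgt lt_ac.
  + by rewrite leqnSn ltn_eqF.
Qed.

(** The coefficient of the vector moving one unit from place i to place i + 1 in the
row for q = j is the difference of the i-th partial sums of these rows, which is
nonnegative by dominance. *)
Lemma coset_le_of_dominance m (D D' : 'M[int]_n) (K K' : mpoly.multinom (n * n))
    gam gam' :
    GT_diagram m D -> GT_diagram m D' ->
    (forall q p, (row_content q.+1 p K)%:Z = D p q) ->
    (forall q p, (row_content q.+1 p K')%:Z = D' p q) ->
    shift_vector D gam -> shift_vector D' gam' -> dominated K K' ->
  coset_le gam gam'.
Proof.
move=> [low top _] [low' top' _] hK hK' hgam hgam' dom.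
pose S i j := (top_content j.+1 i.+1 K - top_content j.+1 i.+1 K')%N.
have topS q p L : top_content q.+1 p.+1 L =
    (top_content q.+1 p L + row_content q.+1 p L)%N.
  rewrite /top_content (bigD1 p) //= addnC; congr addn; apply: eq_bigl => c.
  by rewrite -val_eqE /=; lia.
have SE i j : (S i j)%:Z = (top_content j.+1 i.+1 K)%:Z - (top_content j.+1 i.+1 K')%:Z.
  by rewrite subzn //; have [h _] := dom j.+1; apply: h.
pose v := \sum_i \sum_j elementary i j *+ S i j.
have [s vE] : cone v.
  rewrite /v; apply: big_ind; [exact: cone0 | exact: coneD | move=> i _].
  apply: big_ind; [exact: cone0 | exact: coneD | move=> j _].
  exact/cone_muln/cone_elementary.
exists s; rewrite -vE => p q pq; rewrite raddfB raddfD /= hgam // hgam' //.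
rewrite /v (raddf_sum (level_sum p q)) /=.
have elemE i : level_sum p q (\sum_j elementary i j *+ S i j) =
    if [&& (i < q)%N & (q.+1 < n)%N] then
      ((p == i.+1 :> nat)%:R - (p == i)%:R) *+ S i q else 0.
  rewrite (raddf_sum (level_sum p q)) (bigD1 q) //= big1 ?addr0 => [|j jq].
    rewrite raddfMn /= level_sum_elementary // eqxx andbT.
    by case: ifP => _ //; rewrite mul0rn.
  by rewrite raddfMn /= level_sum_elementary // eq_sym (negPf jq) !andbF mul0rn.
rewrite (eq_bigr _ (fun i _ => elemE i)) -hK -hK'.
(* the last rows of both diagrams are m, and no vector acts on them *)
have [qn | nq] := ltnP q.+1 n; last first.
  have qn : q.+1 = n by apply/eqP; rewrite eqn_leq nq ltn_ord.
  rewrite big1 => [|i _]; last by rewrite andbF.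
  by rewrite addr0 hK hK' top // top' // subrr.
pose F t : int := (top_content q.+1 t K)%:Z - (top_content q.+1 t K')%:Z.
(* F t is the difference of the t-th partial sums in the row for q *)
have F0 : F 0%N = 0.
  by rewrite /F /top_content !big_pred0.
have Fq : F q.+1 = 0.
  have tc_q L D0 : (forall p q : 'I_n, (q < p)%N -> D0 p q = 0) ->
      (forall q p, (row_content q.+1 p L)%:Z = D0 p q) ->
      top_content q.+1 q.+1 L = top_content q.+1 n L.
    move=> low0 hL; rewrite /top_content big_mkcond [RHS]big_mkcond.
    apply: eq_bigr => r _ /=.
    rewrite ltn_ord; case: ltnP => // qr; apply/eqP.
    by rewrite -eqz_nat hL low0.
  rewrite /F (tc_q _ _ low hK) (tc_q _ _ low' hK').
  by have [_ ->] := dom q.+1; rewrite subrr.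
have rowF : (row_content q.+1 p K)%:Z - (row_content q.+1 p K')%:Z = F p.+1 - F p.
  rewrite /F !topS !PoszD; ring.
have -> : \sum_(i < n) (if (i < q)%N && true then
    ((p == i.+1 :> nat)%:R - (p == i)%:R) *+ S i q else 0) =
    \sum_(i < n | (i < q)%N) F i.+1 * (p == i.+1 :> nat)%:R -
    \sum_(i < n | (i < q)%N) F i.+1 * (p == i)%:R.
  rewrite -sumrB [RHS]big_mkcond /=; apply: eq_bigr => i _; rewrite andbT.
  case: ifP => // _; rewrite -mulr_natr [(S i q)%:R]natz SE -/(F i.+1); ring.
have -> : \sum_(i < n | (i < q)%N) F i.+1 * (p == i.+1 :> nat)%:R = F p.
  case: (posnP p) => [p0|p0].
    by rewrite big1 ?p0 ?F0 // => i _; rewrite mulr0.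
  have lt_p : (p.-1 < n)%N by apply: leq_ltn_trans (leq_pred _) (ltn_ord p).
  rewrite (bigD1 (Ordinal lt_p)) /=; last by rewrite prednK.
  rewrite prednK // eqxx mulr1 big1 ?addr0 // => i /andP[_ ip].
  case: eqP => [e|]; last by rewrite mulr0.
  by case/eqP: ip; apply: val_inj; rewrite /= e.
have -> : \sum_(i < n | (i < q)%N) F i.+1 * (p == i)%:R = F p.+1.
  have [lt_pq | le_qp] := ltnP p q.
    rewrite (bigD1 p) //= eqxx mulr1 big1 ?addr0 // => i /andP[_ /negPf].
    by rewrite eq_sym => ->; rewrite mulr0.
  have -> : (p : nat) = q by apply/eqP; rewrite eqn_leq pq le_qp.
  rewrite Fq big1 // => i iq; case: eqP => [e|]; last by rewrite mulr0.
  by move: iq; rewrite -e ltnNge le_qp.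
by rewrite addrAC rowF; ring.
Qed.

End Cone.

Theorem theorem4 (R : realType) (n : nat) (hn : (2 <= n)%N)
  (m : 'I_n -> int)
  (hm : forall p p' : 'I_n, (p <= p')%N -> m p' <= m p)
  (hm0 : forall p : 'I_n, p.+1 = n -> m p = 0)
  (gam : 'M[int]_n -> {ffun psub n -> int})
  (hgam : forall D, GT_diagram m D -> shift_vector D (gam D))
  (G : 'M[int]_n -> GL R[i] n -> R[i]^o)
  (hG : forall D, GT_diagram m D -> GT_vector m D (G D)) :
  forall D, GT_diagram m D ->
    exists c : 'M[int]_n -> R[i],
      c D != 0 /\
      Fvec (gam D) =
        \sum_(D' \in [set D' | GT_diagram m D' /\ coset_le (gam D) (gam D')])
          c D' *: G D'.
Proof.
move=> D0 GTD0.
have /choice[g hg] : forall D, exists g : mpoly.mpoly (n * n) R[i], GT_diagram m D ->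
    [/\ G D = ev g, left_highest (top_row m) g, g != 0,
        forall q p : 'I_n, (row_content q.+1 p (mlead g))%:Z = D p q &
        forall k, k \in msupp g -> dominated (mlead g) k].
  move=> D; case: (pselect (GT_diagram m D)) => [GTD|nGTD]; last by exists 0.
  have [g [Gg gh g0 hq]] := GT_vector_poly hm hm0 GTD (hG D GTD).
  have [gc gd] := GT_poly_content GTD gh g0 hq.
  exists g => _; split=> // q p; rewrite gc gez0_abs //.
  exact: (GT_diagram_ge0 hm hm0 p q GTD).
have lead_eq D K : GT_diagram m D ->
    (forall q p : 'I_n, (row_content q.+1 p K)%:Z = D p q) ->
    mlead (g D) = K.
  move=> /hg[_ _ _ gc _] hK; apply: row_content_inj => q p.
  by apply/eqP; rewrite -eqz_nat gc hK.
have [gamma_dom gamma_lead] : (forall k, k \in msupp (gamma_poly R[i] D0) ->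
    dominated (mlead (g D0)) k) /\ mcoeff (mlead (g D0)) (gamma_poly R[i] D0) != 0.
  have [_ _ _ gc _] := hg D0 GTD0.
  apply: (gamma_poly_lead R[i] hm hm0 GTD0) => q p.
  by apply/eqP; rewrite -eqz_nat gc gez0_abs // (GT_diagram_ge0 hm hm0 p q GTD0).
have lead_adm (f : mpoly.mpoly (n * n) R[i]) : f != 0 -> left_highest (top_row m) f ->
    exists2 D, GT_diagram m D & mlead (g D) = mlead f.
  move=> f0 fh; have GTf := GT_diagram_mlead hm hm0 f0 fh.
  exists (\matrix_(p, q) (row_content q.+1 p (mlead f))%:Z) => //.
  by apply: lead_eq => // q p; rewrite mxE.
have lead_inj D D' : GT_diagram m D -> GT_diagram m D' ->
    mlead (g D) = mlead (g D') -> D = D'.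
  move=> /hg[_ _ _ gc _] /hg[_ _ _ gc' _] e; apply/matrixP => p q.
  by rewrite -gc -gc' e.
have g_highest D : GT_diagram m D -> left_highest (top_row m) (g D) by case/hg.
have g_neq0 D : GT_diagram m D -> g D != 0 by case/hg.
have g_dom D : GT_diagram m D ->
    forall k, k \in msupp (g D) -> dominated (mlead (g D)) k.
  by case/hg.
have [s [c [us sP [D0s cD0] fE]]] := triangular_expansion g_highest g_neq0 g_dom
  lead_adm lead_inj GTD0 (left_highest_gamma_poly R[i] hm hm0 GTD0)
  gamma_dom gamma_lead.
exists (fun D => if D \in s then c D else 0); rewrite D0s; split=> //.
rewrite (Fvec_gamma_poly R[i] hm hm0 GTD0 (hgam D0 GTD0)) fE.
rewrite (fsbigE s) //=; first last.
- by move=> D _ /negPf ->; rewrite scale0r.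
- move=> D Ds; have [GTD dom] := sP D Ds; split=> //.
  have [_ _ _ gc _] := hg D0 GTD0; have [_ _ _ gc' _] := hg D GTD.
  by apply: (coset_le_of_dominance GTD0 GTD gc gc') dom; apply: hgam.
have -> : forall s' : seq 'M[int]_n, ev (\sum_(D <- s') c D *: g D) =
    \sum_(D <- s') c D *: ev (g D).
  elim=> [|D s' IH]; first by rewrite !big_nil ev0.
  by rewrite !big_cons ev_linear IH.
rewrite [RHS]big_seq_cond [LHS]big_seq; apply: eq_big => [D|D Ds].
  case: (boolP (D \in s)) => //= Ds; symmetry; apply/mem_set.
  have [GTD dom] := sP D Ds; split=> //.
  have [_ _ _ gc _] := hg D0 GTD0; have [_ _ _ gc' _] := hg D GTD.
  by apply: (coset_le_of_dominance GTD0 GTD gc gc') dom; apply: hgam.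
have [/hg[-> _ _ _ _] _] := sP D Ds.
by rewrite Ds.
Qed.
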